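(* Fix a positive integer $r$ and, for each $1\le i\le r$, fix $A_i\in\mathbb{C}$ and nonnegative integers $n_i,m_i$ with $n_i+m_i\ge 2$. Then there are only finitely many eigenforms $h$ for which there exist, for each $1\le i\le r$, a product $P_i$ of $n_i$ Eisenstein series and a product $F_i$ of $m_i$ cuspidal eigenforms such that \[ \sum_{i=1}^{r}A_iP_iF_i=h. \]
   Context: All modular forms are for $\mathrm{SL}_2(\mathbb{Z})$, with Fourier expansion $f(z)=\sum_{n\ge0}a_f(n)q^n$, $q=e^{2\pi i z}$. For even $k\ge4$, the Eisenstein series is $E_k(z)=1+C_k\sum_{n\ge1}\sigma_{k-1}(n)q^n$ with $C_k=\frac{(2\pi i)^k}{(k-1)!\zeta(k)}=-2k/B_k$. A cuspidal eigenform is a cuspidal Hecke eigenform of level one normalized by $a_f(1)=1$; an eigenform is either some $E_k$ or a cuspidal eigenform. An empty product equals $1$. In the identity, each term $P_iF_i$ is a modular form of the same weight as $h$. *)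

(* Defs.v *)
From Stdlib Require Import Reals ZArith List.
From Coquelicot Require Import Coquelicot.

Open Scope C_scope.

(** Finite sums and products of complex numbers, indexed by a list. *)
Definition Csum {T : Type} (F : T -> C) (l : list T) : C :=
  fold_right Cplus (RtoC 0) (map F l).

Definition Cprod {T : Type} (F : T -> C) (l : list T) : C :=
  fold_right Cmult (RtoC 1) (map F l).

Definition divisors (n : nat) : list nat :=
  filter (fun d => Nat.eqb (n mod d) 0) (seq 1 n).

Definition divisor_sigma (s n : nat) : nat :=
  list_sum (map (fun d => Nat.pow d s) (divisors n)).

Definition Cexp (w : C) : C :=
  (exp (Re w) * cos (Im w), exp (Re w) * sin (Im w))%R.

Definition q (z : C) : C := Cexp (RtoC 2 * RtoC PI * Ci * z).

(** A function on the upper half-plane is represented by a total function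
    [C -> C], of which only the values on [upper] matter: equality of forms
    always means equality on [upper]. *)
Definition upper (z : C) : Prop := (0 < Im z)%R.

Definition holomorphic (f : C -> C) : Prop :=
  forall z : C, upper z -> ex_derive (K := C_AbsRing) (V := C_NormedModule) f z.

Definition fourier (f : C -> C) (a : nat -> C) : Prop :=
  forall z : C, upper z ->
    is_series (K := C_AbsRing) (V := C_NormedModule)
      (fun n => a n * q z ^ n) (f z).

(** The last conjunct is holomorphy at infinity. *)
Definition modular_form (k : nat) (f : C -> C) : Prop :=
  holomorphic f /\
  (forall (a b c d : Z) (z : C), (a * d - b * c = 1)%Z -> upper z ->
     f ((RtoC (IZR a) * z + RtoC (IZR b)) / (RtoC (IZR c) * z + RtoC (IZR d)))
     = (RtoC (IZR c) * z + RtoC (IZR d)) ^ k * f z) /\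
  (exists a : nat -> C, fourier f a).

Definition cusp_form (k : nat) (f : C -> C) : Prop :=
  modular_form k f /\ exists a : nat -> C, fourier f a /\ a 0%nat = RtoC 0.

(** [T_n f (z) = n^(k-1) \sum_(a d = n, 0 <= b < d) d^(-k) f ((a z + b) / d)].
    The truncation in [k - 1] is harmless: there is no nonzero cusp form of
    weight 0. *)
Definition hecke (k n : nat) (f : C -> C) (z : C) : C :=
  RtoC (INR n) ^ (k - 1) *
  Csum (fun d : nat =>
          / RtoC (INR d) ^ k *
          Csum (fun b : nat =>
                  f ((RtoC (INR (n / d)) * z + RtoC (INR b)) / RtoC (INR d)))
               (seq 0 d))
       (divisors n).

(** The normalization [a 1 = 1] makes [f] nonzero. *)
Definition cuspidal_eigenform (k : nat) (f : C -> C) : Prop :=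
  cusp_form k f /\
  (forall n : nat, (1 <= n)%nat ->
     exists lambda : C, forall z : C, upper z -> hecke k n f z = lambda * f z) /\
  (exists a : nat -> C, fourier f a /\ a 1%nat = RtoC 1).

Definition zeta (k : nat) : R := Series (fun n : nat => / INR (S n) ^ k)%R.

(** [C_k], that is [- 2 k / B_k] *)
Definition eisenstein_const (k : nat) : C :=
  (RtoC 2 * RtoC PI * Ci) ^ k / RtoC (INR (fact (k - 1)) * zeta k).

Definition eisenstein_coef (k n : nat) : C :=
  match n with
  | O => RtoC 1
  | S _ => eisenstein_const k * RtoC (INR (divisor_sigma (k - 1) n))
  end.

(** [f] is the Eisenstein series [E_k]; its Fourier series determines [f] on
    [upper]. *)
Definition eisenstein (k : nat) (f : C -> C) : Prop :=
  (4 <= k)%nat /\ Nat.Even k /\ fourier f (eisenstein_coef k).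

Definition eigenform (k : nat) (f : C -> C) : Prop :=
  eisenstein k f \/ cuspidal_eigenform k f.

(** [P] is a product of [n] functions, each in the class [Phi] with a weight, the
    weights having sum [w]; the factors are listed with their weights. *)
Definition product_of (Phi : nat -> (C -> C) -> Prop) (n w : nat) (P : C -> C)
  : Prop :=
  exists l : list (nat * (C -> C)),
    length l = n /\
    (forall kf, In kf l -> Phi (fst kf) (snd kf)) /\
    list_sum (map fst l) = w /\
    forall z : C, upper z -> P z = Cprod (fun kf => snd kf z) l.

(** Finiteness of a class of functions on [upper] *)
Definition finitely_many (Q : (C -> C) -> Prop) : Prop :=
  exists L : list (C -> C), forall h : C -> C, Q h ->
    exists g : C -> C, In g L /\ forall z : C, upper z -> h z = g z.

(* Main.v *)
(** Compare Fourier coefficients at fixed indices, uniformly in the weight [k] of [h].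

    Cuspidal [h]: with [p] prime, [a(p)^2 = a(p^2) + p^(k-1)], so [a(p)] or [a(p^2)] has the
    size of [N^((k-1)/2)] with [N = p] or [N = p^2].  The coefficients of each Eisenstein
    series at a fixed index are bounded independently of the weight, and a cuspidal eigenform
    of weight [v] satisfies [|a(N)| <= N^(v/2+1)].  In a product with a second factor, either
    that factor is an Eisenstein series, the leading term is [a(N)] with [v <= k - 4], and all
    others involve [(N-1)^(k/2)] only; or all factors are cuspidal and only indices below [N]
    occur.  So the left-hand side at [N] is at most a constant, independent of [p], times
    [N^(k/2-1)], a contradiction when [p] and then [k] are large.

    [h = E_k]: the coefficient at [1] gives a linear relation, with fixed coefficients, between
    [1], [C_k] and a bounded number of [C_w] with [w < k]; the superexponential decay of [C_w]
    forbids this for large [k].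

    In each weight there are finitely many eigenforms, because eigenforms with different
    coefficients are linearly independent and a cusp form vanishing to high order at infinity
    is zero. *)
Require Import Defs.
From Stdlib Require Import Reals ZArith List Lra Lia Psatz Permutation Classical.
From Coquelicot Require Import Coquelicot.

Local Open Scope C_scope.
Local Notation cseries := (is_series (K := C_AbsRing) (V := C_NormedModule)).

(** The exponents decide the cuspidal case. Measured against [N^(k/2)], the bound [N^(v/2+1)] loses
    a factor [N], while an Eisenstein factor has weight at least 4 and gains [N^2]; the net gain [N]
    beats the factor [p^(1/2)] by which [p^((k-1)/2)] falls short of [p^(k/2)]. The order of choices
    matters: [p] is chosen from the [A_i] alone, and the threshold for [k] afterwards from [p], the
    [n_i] and the [m_i]. So the constant at [N^(k/2-1)] must be independent of [N], whereas the one
    at [(N-1)^(k/2)] may depend on it. For [h = E_k] the obstacle is that the weights [w] vary with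
    the solution, so the [C_w] are not fixed numbers. Only the list of their multipliers is fixed,
    and a threshold uniform in the weights is found by induction on the length of that list. The
    decay comes from [|C_w| = (2 pi)^w / ((w-1)! zeta(w))] with [1 <= zeta(w) <= 2]. The analytic
    input is elementary: averages of [f] over points of a horizontal line, and bounds for the
    invariant function [|f(z)| Im(z)^(k/2)]. *)

(** * Finite sums *)

Lemma Csum_nil (T : Type) (F : T -> C) : Csum F nil = 0.
Proof. reflexivity. Qed.

Lemma Csum_cons (T : Type) (F : T -> C) x l : Csum F (x :: l) = F x + Csum F l.
Proof. reflexivity. Qed.

Lemma Csum_app (T : Type) (F : T -> C) l l' : Csum F (l ++ l') = Csum F l + Csum F l'.
Proof.
  induction l as [|x l IH]; simpl app.
  - rewrite Csum_nil. ring.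
  - rewrite !Csum_cons, IH. ring.
Qed.

Lemma Csum_ext (T : Type) (F G : T -> C) l :
  (forall x, In x l -> F x = G x) -> Csum F l = Csum G l.
Proof.
  induction l as [|x l IH]; intros H; [reflexivity|].
  rewrite !Csum_cons, (H x), IH; [reflexivity| |]; simpl; auto.
  intros y Hy. apply H. simpl; auto.
Qed.

Lemma Csum_0 (T : Type) (F : T -> C) l : (forall x, In x l -> F x = 0) -> Csum F l = 0.
Proof.
  induction l as [|x l IH]; intros H; [reflexivity|].
  rewrite Csum_cons, (H x), IH; [ring| |]; simpl; auto.
  intros y Hy. apply H. simpl; auto.
Qed.

Lemma Csum_plus (T : Type) (F G : T -> C) l :
  Csum (fun x => F x + G x) l = Csum F l + Csum G l.
Proof.
  induction l as [|x l IH]; [rewrite !Csum_nil; ring|].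
  rewrite !Csum_cons, IH. ring.
Qed.

Lemma Csum_scal (T : Type) (F : T -> C) c l : Csum (fun x => c * F x) l = c * Csum F l.
Proof.
  induction l as [|x l IH]; [rewrite !Csum_nil; ring|].
  rewrite !Csum_cons, IH. ring.
Qed.

Lemma Csum_const (T : Type) c (l : list T) : Csum (fun _ => c) l = RtoC (INR (length l)) * c.
Proof.
  induction l as [|x l IH]; [simpl; rewrite Csum_nil; ring|].
  rewrite !Csum_cons, IH. simpl length. rewrite S_INR, RtoC_plus. ring.
Qed.

Lemma Csum_perm (T : Type) (F : T -> C) l l' : Permutation l l' -> Csum F l = Csum F l'.
Proof.
  induction 1 as [|x l l' _ IH|x y l|l l' l'' _ IH1 _ IH2].
  - reflexivity.
  - now rewrite !Csum_cons, IH.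
  - rewrite !Csum_cons. ring.
  - congruence.
Qed.

Lemma Csum_map (S T : Type) (g : S -> T) (F : T -> C) l :
  Csum F (map g l) = Csum (fun x => F (g x)) l.
Proof. unfold Csum. now rewrite map_map. Qed.

Lemma Csum_seq_S (F : nat -> C) s n :
  Csum F (seq s (S n)) = Csum F (seq s n) + F (s + n)%nat.
Proof. rewrite seq_S, Csum_app, Csum_cons, Csum_nil. ring. Qed.

Lemma Csum_only (T : Type) (F : T -> C) l x :
  NoDup l -> In x l -> (forall y, In y l -> y <> x -> F y = 0) -> Csum F l = F x.
Proof.
  intros Hd Hx H0. destruct (in_split x l Hx) as [l1 [l2 ->]].
  rewrite Csum_app, Csum_cons.
  apply NoDup_remove_2 in Hd.
  rewrite !(Csum_0 T F).
  - ring.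
  - intros y Hy. apply H0; [apply in_or_app; simpl; auto|].
    intros ->. apply Hd, in_or_app; auto.
  - intros y Hy. apply H0; [apply in_or_app; simpl; auto|].
    intros ->. apply Hd, in_or_app; auto.
Qed.

Definition Rsum {T : Type} (F : T -> R) (l : list T) : R := fold_right Rplus 0%R (map F l).

Lemma Rsum_cons (T : Type) (F : T -> R) x l : Rsum F (x :: l) = (F x + Rsum F l)%R.
Proof. reflexivity. Qed.

Lemma Rsum_le (T : Type) (F G : T -> R) l :
  (forall x, In x l -> (F x <= G x)%R) -> (Rsum F l <= Rsum G l)%R.
Proof.
  induction l as [|x l IH]; intros H; [apply Rle_refl|].
  rewrite !Rsum_cons. apply Rplus_le_compat.
  - apply H; simpl; auto.
  - apply IH. intros y Hy; apply H; simpl; auto.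
Qed.

Lemma Rsum_const (T : Type) c (l : list T) : Rsum (fun _ => c) l = (INR (length l) * c)%R.
Proof.
  induction l as [|x l IH]; [simpl; unfold Rsum; simpl; ring|].
  rewrite !Rsum_cons, IH. simpl length. rewrite S_INR. ring.
Qed.

Lemma Rsum_scal (T : Type) (F : T -> R) c l : Rsum (fun x => F x * c)%R l = (Rsum F l * c)%R.
Proof.
  induction l as [|x l IH]; [unfold Rsum; simpl; ring|].
  rewrite !Rsum_cons, IH. ring.
Qed.

Lemma Rsum_ge0 (T : Type) (F : T -> R) l :
  (forall x, In x l -> (0 <= F x)%R) -> (0 <= Rsum F l)%R.
Proof.
  intros H. replace 0%R with (Rsum (fun _ : T => 0%R) l) by (rewrite Rsum_const; ring).
  now apply Rsum_le.
Qed.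

Lemma Cmod_Csum (T : Type) (F : T -> C) l :
  (Cmod (Csum F l) <= Rsum (fun x => Cmod (F x)) l)%R.
Proof.
  induction l as [|x l IH].
  - rewrite Csum_nil, Cmod_0. apply Rle_refl.
  - rewrite Csum_cons, Rsum_cons.
    eapply Rle_trans; [apply Cmod_triangle|]. now apply Rplus_le_compat_l.
Qed.

Lemma Cmod_Csum_le (T : Type) (F : T -> C) l B :
  (forall x, In x l -> (Cmod (F x) <= B)%R) -> (Cmod (Csum F l) <= INR (length l) * B)%R.
Proof.
  intros H. eapply Rle_trans; [apply Cmod_Csum|].
  rewrite <- Rsum_const. now apply Rsum_le.
Qed.

Lemma Cmod_pow (c : C) n : Cmod (c ^ n) = (Cmod c ^ n)%R.
Proof.
  induction n as [|n IH]; simpl; [apply Cmod_1|].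
  now rewrite Cmod_mult, IH.
Qed.

Lemma Cmod_INR n : Cmod (RtoC (INR n)) = INR n.
Proof. rewrite Cmod_R. apply Rabs_pos_eq, pos_INR. Qed.

(** * Complex series *)

Lemma fst_sum_n (u : nat -> C) n :
  fst (sum_n (G := C_AbelianMonoid) u n) = sum_n (fun i => fst (u i)) n.
Proof.
  induction n as [|n IH]; [now rewrite !sum_O|].
  rewrite !sum_Sn, <- IH. reflexivity.
Qed.

Lemma snd_sum_n (u : nat -> C) n :
  snd (sum_n (G := C_AbelianMonoid) u n) = sum_n (fun i => snd (u i)) n.
Proof.
  induction n as [|n IH]; [now rewrite !sum_O|].
  rewrite !sum_Sn, <- IH. reflexivity.
Qed.

Lemma cseries_iff (u : nat -> C) (l : C) :
  cseries u l <-> is_series (fun n => fst (u n)) (fst l) /\ is_series (fun n => snd (u n)) (snd l).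
Proof.
  unfold is_series. split.
  - intros H. assert (H1 := proj1 (filterlim_locally _ _) H). split; apply filterlim_locally;
    intros eps; destruct (H1 eps) as [N HN]; exists N; intros n Hn; destruct (HN n Hn) as [Ha Hb].
    + now rewrite <- fst_sum_n.
    + now rewrite <- snd_sum_n.
  - intros [Ha Hb]. assert (Ha1 := proj1 (filterlim_locally _ _) Ha).
    assert (Hb1 := proj1 (filterlim_locally _ _) Hb).
    apply filterlim_locally. intros eps. destruct (Ha1 eps) as [N HN]. destruct (Hb1 eps) as [N' HN'].
    exists (Nat.max N N'). intros n Hn. split.
    + change (ball (fst l) eps (fst (sum_n (G := C_AbelianMonoid) u n))). rewrite fst_sum_n. apply HN. lia.
    + change (ball (snd l) eps (snd (sum_n (G := C_AbelianMonoid) u n))). rewrite snd_sum_n. apply HN'. lia.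
Qed.

Lemma cseries_unique (u : nat -> C) (l l' : C) : cseries u l -> cseries u l' -> l = l'.
Proof.
  rewrite !cseries_iff. intros [H1 H2] [H3 H4].
  apply is_series_unique in H1, H2, H3, H4.
  destruct l, l'; simpl in *; congruence.
Qed.

Lemma cseries_ext (u v : nat -> C) (l : C) : (forall n, u n = v n) -> cseries u l -> cseries v l.
Proof. apply is_series_ext. Qed.

Lemma cseries_plus (u v : nat -> C) (l l' : C) : cseries u l -> cseries v l' -> cseries (fun n => u n + v n) (l + l').
Proof. intros H H'. exact (is_series_plus _ _ _ _ H H'). Qed.

Lemma cseries_scal (c : C) (u : nat -> C) (l : C) : cseries u l -> cseries (fun n => c * u n) (c * l).
Proof. intros H. exact (is_series_scal c _ _ H). Qed.

Lemma cseries_zero : cseries (fun _ => RtoC 0) (RtoC 0).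
Proof.
  unfold is_series. apply (filterlim_ext (fun _ => zero)); [|apply filterlim_const].
  intros n. symmetry. induction n as [|n IH]; [now rewrite sum_O|].
  rewrite sum_Sn, IH. apply (plus_zero_l (G := C_AbelianGroup)).
Qed.

Lemma cseries_Csum (T : Type) (u : T -> nat -> C) (s : T -> C) l :
  (forall x, In x l -> cseries (u x) (s x)) ->
  cseries (fun n => Csum (fun x => u x n) l) (Csum s l).
Proof.
  induction l as [|x l IH]; intros H.
  - exact cseries_zero.
  - rewrite Csum_cons. apply (cseries_plus (u x) (fun n => Csum (fun y => u y n) l)).
    + apply H; simpl; auto.
    + apply IH. intros y Hy; apply H; simpl; auto.
Qed.

Lemma fst_le_Cmod (z : C) : (Rabs (fst z) <= Cmod z)%R.
Proof. eapply Rle_trans; [apply Rmax_l|apply Rmax_Cmod]. Qed.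

Lemma snd_le_Cmod (z : C) : (Rabs (snd z) <= Cmod z)%R.
Proof. eapply Rle_trans; [apply Rmax_r|apply Rmax_Cmod]. Qed.

Lemma Cmod_le_abs (z : C) : (Cmod z <= Rabs (fst z) + Rabs (snd z))%R.
Proof.
  replace z with (RtoC (fst z) + RtoC (snd z) * Ci) at 1.
  - eapply Rle_trans; [apply Cmod_triangle|].
    rewrite Cmod_mult, !Cmod_R, Cmod_Ci. lra.
  - destruct z as [x y]. unfold Cplus, Cmult, RtoC, Ci; simpl. f_equal; ring.
Qed.

Lemma is_series_le (u v : nat -> R) l m :
  (forall n, (u n <= v n)%R) -> is_series u l -> is_series v m -> (l <= m)%R.
Proof.
  intros H Hu Hv.
  apply (is_lim_seq_le (sum_n u) (sum_n v) l m); [|exact Hu|exact Hv].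
  intros n. unfold sum_n. apply sum_n_m_le. exact H.
Qed.

(** Projecting on the direction of [l] reduces this to a comparison of real series. *)
Lemma cseries_Cmod_le (u : nat -> C) (x : nat -> R) l X :
  (forall n, (Cmod (u n) <= x n)%R) -> cseries u l -> is_series x X -> (Cmod l <= X)%R.
Proof.
  intros Hle Hu Hx.
  destruct (Req_dec (Cmod l) 0) as [H0|H0].
  - rewrite H0. apply (is_series_le (fun _ => 0%R) x 0 X); [|exact (proj1 (proj1 (cseries_iff _ _) cseries_zero))|exact Hx].
    intros n. eapply Rle_trans; [apply Cmod_ge_0|apply Hle].
  - set (e := Cconj l / RtoC (Cmod l)).
    assert (He : Cmod e = 1%R).
    { unfold e. rewrite Cmod_div, Cmod_conj, Cmod_R, Rabs_pos_eq; [field; exact H0|apply Cmod_ge_0|].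
      intros E. apply H0. injection E as E. exact E. }
    assert (Hel : e * l = RtoC (Cmod l)).
    { unfold e. assert (E : RtoC (Cmod l) <> 0) by (intros E; apply H0; injection E as E; exact E).
      transitivity (l * Cconj l / RtoC (Cmod l)); [field; exact E|].
      rewrite <- Cmod2_conj. rewrite RtoC_pow. field. exact E. }
    apply (cseries_scal e) in Hu. rewrite Hel in Hu.
    apply cseries_iff in Hu. destruct Hu as [Hu _].
    refine (is_series_le _ _ _ _ _ Hu Hx).
    intros n. eapply Rle_trans; [apply Rle_abs|]. eapply Rle_trans; [apply fst_le_Cmod|].
    rewrite Cmod_mult, He, Rmult_1_l. apply Hle.
Qed.

Definition conv (a b : nat -> C) (n : nat) : C := Csum (fun j => a j * b (n - j)%nat) (seq 0 (S n)).

Lemma fst_Csum (T : Type) (F : T -> C) l : fst (Csum F l) = Rsum (fun x => fst (F x)) l.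
Proof. induction l as [|x l IH]; [reflexivity|]. rewrite Csum_cons, Rsum_cons, <- IH. reflexivity. Qed.

Lemma snd_Csum (T : Type) (F : T -> C) l : snd (Csum F l) = Rsum (fun x => snd (F x)) l.
Proof. induction l as [|x l IH]; [reflexivity|]. rewrite Csum_cons, Rsum_cons, <- IH. reflexivity. Qed.

Lemma Rsum_app (T : Type) (F : T -> R) l l' : Rsum F (l ++ l') = (Rsum F l + Rsum F l')%R.
Proof.
  induction l as [|x l IH]; simpl app; [unfold Rsum at 2; simpl; ring|].
  rewrite !Rsum_cons, IH. ring.
Qed.

Lemma Rsum_seq_sum_f (F : nat -> R) n : Rsum F (seq 0 (S n)) = sum_f_R0 F n.
Proof.
  induction n as [|n IH]; [unfold Rsum; simpl; ring|].
  rewrite seq_S, Rsum_app, IH. unfold Rsum; simpl. ring.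
Qed.

(** Reduces to the real theorem on Cauchy products, applied to the four products of real and
    imaginary parts; their absolute convergence follows by comparison with the moduli. *)
Lemma cseries_conv (u v : nat -> C) l m :
  cseries u l -> cseries v m ->
  ex_series (fun n => Cmod (u n)) -> ex_series (fun n => Cmod (v n)) ->
  cseries (conv u v) (l * m).
Proof.
  intros Hu Hv Au Av.
  assert (A1 : forall w : nat -> C, ex_series (fun n => Cmod (w n)) -> ex_series (fun n => Rabs (fst (w n)))).
  { intros w Hw. apply (ex_series_le (K := R_AbsRing) (V := R_CompleteNormedModule) _ (fun n => Cmod (w n))); [|exact Hw].
    intros n. unfold norm; simpl. unfold abs; simpl. rewrite Rabs_Rabsolu. apply fst_le_Cmod. }
  assert (A2 : forall w : nat -> C, ex_series (fun n => Cmod (w n)) -> ex_series (fun n => Rabs (snd (w n)))).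
  { intros w Hw. apply (ex_series_le (K := R_AbsRing) (V := R_CompleteNormedModule) _ (fun n => Cmod (w n))); [|exact Hw].
    intros n. unfold norm; simpl. unfold abs; simpl. rewrite Rabs_Rabsolu. apply snd_le_Cmod. }
  apply cseries_iff in Hu, Hv. destruct Hu as [Hu1 Hu2], Hv as [Hv1 Hv2].
  apply cseries_iff. split.
  - assert (H1 := is_series_mult _ _ _ _ Hu1 Hv1 (A1 _ Au) (A1 _ Av)).
    assert (H2 := is_series_mult _ _ _ _ Hu2 Hv2 (A2 _ Au) (A2 _ Av)).
    refine (is_series_ext _ _ _ _ (is_series_minus _ _ _ _ H1 H2)).
    intros n. unfold conv. rewrite fst_Csum, Rsum_seq_sum_f.
    unfold plus, opp; simpl. fold (Rminus (sum_f_R0 (fun k => fst (u k) * fst (v (n - k)%nat)) n) (sum_f_R0 (fun k => snd (u k) * snd (v (n - k)%nat)) n))%R.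
    rewrite <- minus_sum. reflexivity.
  - assert (H1 := is_series_mult _ _ _ _ Hu1 Hv2 (A1 _ Au) (A2 _ Av)).
    assert (H2 := is_series_mult _ _ _ _ Hu2 Hv1 (A2 _ Au) (A1 _ Av)).
    refine (is_series_ext _ _ _ _ (is_series_plus _ _ _ _ H1 H2)).
    intros n. unfold conv. rewrite snd_Csum, Rsum_seq_sum_f.
    unfold plus; simpl. rewrite <- plus_sum. reflexivity.
Qed.

(** On coefficients this is the substitution of [q^d] for [q], the operator usually written
    [V_d]. *)
Definition spread (d : nat) (g : nat -> C) (m : nat) : C :=
  if Nat.eqb (m mod d) 0 then g (m / d)%nat else 0.

Lemma sum_n_spread d g M : (1 <= d)%nat ->
  sum_n (G := C_AbelianMonoid) (spread d g) M = sum_n (G := C_AbelianMonoid) g (M / d).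
Proof.
  intros Hd. induction M as [|M IH].
  - rewrite Nat.Div0.div_0_l, !sum_O. unfold spread. now rewrite Nat.Div0.mod_0_l, Nat.Div0.div_0_l.
  - rewrite sum_Sn, IH. unfold spread.
    destruct (Nat.eqb_spec (S M mod d) 0) as [E|E].
    + apply Nat.Div0.div_exact in E. set (t := (S M / d)%nat) in *.
      assert (Ht : t <> 0%nat) by (intros ->; lia).
      assert (HM : (M / d = t - 1)%nat).
      { symmetry. apply (Nat.div_unique M d (t - 1) (d - 1)); nia. }
      rewrite HM. destruct t as [|t]; [lia|]. replace (S t - 1)%nat with t by lia.
      now rewrite sum_Sn.
    + assert (HM : (M / d = S M / d)%nat).
      { symmetry; apply (Nat.div_unique M d (S M / d) (S M mod d - 1)).
        - assert (H := Nat.mod_upper_bound (S M) d). lia.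
        - assert (H := Nat.div_mod_eq (S M) d). lia. }
      rewrite HM. apply (plus_zero_r (G := C_AbelianGroup)).
Qed.

Lemma cseries_spread d (g : nat -> C) (l : C) : (1 <= d)%nat -> cseries g l -> cseries (spread d g) l.
Proof.
  intros Hd H. unfold is_series in *.
  apply (filterlim_ext (fun M => sum_n (G := C_AbelianMonoid) g (M / d)%nat)).
  { intros M. symmetry. now apply sum_n_spread. }
  apply (filterlim_comp _ _ _ (fun M => (M / d)%nat) (sum_n (G := C_AbelianMonoid) g) eventually eventually); [|exact H].
  intros P [N HN]. exists (N * d)%nat. intros M HM. apply HN.
  apply Nat.div_le_lower_bound; lia.
Qed.

(** The partial sums of [g] are the subsequence of those of [spread d g] at multiples of [d]. This
    recovers a series from one that is known to be supported on multiples of [d]. *)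
Lemma cseries_unspread d (g : nat -> C) (l : C) : (1 <= d)%nat -> cseries (spread d g) l -> cseries g l.
Proof.
  intros Hd H. unfold is_series in *.
  apply (filterlim_ext (fun t => sum_n (G := C_AbelianMonoid) (spread d g) (t * d)%nat)).
  { intros t. rewrite sum_n_spread by exact Hd. now rewrite Nat.div_mul by lia. }
  apply (filterlim_comp _ _ _ (fun t => (t * d)%nat) (sum_n (G := C_AbelianMonoid) (spread d g)) eventually eventually); [|exact H].
  intros P [N HN]. exists N. intros t Ht. apply HN. nia.
Qed.

(** * Fourier expansions *)

Lemma Cexp_plus v w : Cexp (v + w) = Cexp v * Cexp w.
Proof.
  destruct v as [a b], w as [c d]. unfold Cexp, Re, Im, Cplus, Cmult; simpl.
  rewrite exp_plus, cos_plus, sin_plus. f_equal; ring.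
Qed.

Lemma q_real_imag x y :
  q (x, y) = (exp (- (2 * PI * y)) * cos (2 * PI * x), exp (- (2 * PI * y)) * sin (2 * PI * x))%R.
Proof.
  unfold q. replace (RtoC 2 * RtoC PI * Ci * (x, y)) with ((- (2 * PI * y))%R, (2 * PI * x)%R); [reflexivity|].
  unfold RtoC, Ci, Cmult; simpl. f_equal; ring.
Qed.

Lemma q_plus z w : q (z + w) = q z * q w.
Proof. unfold q. rewrite <- Cexp_plus. f_equal. ring. Qed.

Lemma Cmod_q z : Cmod (q z) = exp (- (2 * PI * Im z)).
Proof.
  destruct z as [x y]. rewrite q_real_imag. unfold Cmod, Im; simpl fst; simpl snd.
  set (e := exp (- (2 * PI * y))). assert (He : (0 < e)%R) by apply exp_pos.
  replace ((e * cos (2 * PI * x)) ^ 2 + (e * sin (2 * PI * x)) ^ 2)%R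
    with (e² * (Rsqr (sin (2 * PI * x)) + Rsqr (cos (2 * PI * x))))%R by (unfold Rsqr; ring).
  rewrite sin2_cos2, Rmult_1_r. apply sqrt_Rsqr. lra.
Qed.

Lemma q_pow z n : q z ^ n = q (RtoC (INR n) * z).
Proof.
  induction n as [|n IH].
  - simpl. rewrite Cmult_0_l. replace (RtoC 0) with (0%R, 0%R) by reflexivity.
    rewrite q_real_imag, !Rmult_0_r, Ropp_0, exp_0, cos_0, sin_0, Rmult_0_r, Rmult_1_l. reflexivity.
  - rewrite S_INR, RtoC_plus, Cmult_plus_distr_r, q_plus, <- IH, Cmult_1_l. simpl. ring.
Qed.

Lemma q_nat n : q (RtoC (INR n)) = 1.
Proof.
  unfold RtoC. rewrite q_real_imag, Rmult_0_r, Ropp_0, exp_0, !Rmult_1_l.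
  replace (2 * PI * INR n)%R with (0 + 2 * INR n * PI)%R by ring.
  rewrite cos_period, sin_period, cos_0, sin_0. reflexivity.
Qed.

Lemma q_neq_1 x : (0 < x < 1)%R -> q (RtoC x) <> 1.
Proof.
  intros Hx. unfold RtoC. rewrite q_real_imag, Rmult_0_r, Ropp_0, exp_0, !Rmult_1_l.
  replace (2 * PI * x)%R with (2 * (PI * x))%R by ring. rewrite cos_2a_sin.
  assert (Hs : (0 < sin (PI * x))%R).
  { assert (HP := PI_RGT_0). apply sin_gt_0; nra. }
  intros E. injection E as E _. nra.
Qed.

Lemma Cgeom_sum (w : C) n : (w - 1) * Csum (fun j => w ^ j) (seq 0 n) = w ^ n - 1.
Proof.
  induction n as [|n IH]; [rewrite Csum_nil; simpl; ring|].
  rewrite Csum_seq_S, Cmult_plus_distr_l, IH. simpl. ring.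
Qed.

(** Orthogonality of the additive characters modulo [d]. Reducing [m] to its residue [s] turns the
    summands into powers of one root of unity [w], and the geometric sum vanishes because [w <> 1]
    for [0 < s < d]. *)
Lemma q_average d m : (1 <= d)%nat ->
  Csum (fun b => q (RtoC (INR b / INR d)) ^ m) (seq 0 d)
  = if Nat.eqb (m mod d) 0 then RtoC (INR d) else 0.
Proof.
  intros Hd. assert (Hd' : (0 < INR d)%R) by (apply lt_0_INR; lia).
  assert (Hm := Nat.div_mod_eq m d). assert (Hr := Nat.mod_upper_bound m d ltac:(lia)).
  set (t := (m / d)%nat) in *. set (s := (m mod d)%nat) in *.
  set (w := q (RtoC (INR s / INR d))).
  assert (E : forall b, q (RtoC (INR b / INR d)) ^ m = w ^ b).
  { intros b. unfold w. rewrite !q_pow, <- !RtoC_mult.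
    replace (INR m * (INR b / INR d))%R with (INR (t * b) + INR b * (INR s / INR d))%R.
    - rewrite RtoC_plus, q_plus, q_nat. ring.
    - rewrite Hm, plus_INR, !mult_INR. field. lra. }
  rewrite (Csum_ext _ _ (fun b => w ^ b)) by auto.
  destruct (Nat.eqb_spec s 0) as [E0|E0].
  - assert (Hw : w = 1).
    { unfold w. rewrite E0. simpl. replace (0 / INR d)%R with (INR 0) by (simpl; field; lra). apply q_nat. }
    rewrite (Csum_ext _ _ (fun _ => 1)).
    + rewrite Csum_const, length_seq. ring.
    + intros b _. rewrite Hw. apply Cpow_1_l.
  - assert (Hw : w - 1 <> 0).
    { intros F. apply Ceq_minus in F. revert F. apply q_neq_1. split.
      - apply Rdiv_lt_0_compat; [apply lt_0_INR; lia|exact Hd'].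
      - apply Rmult_lt_reg_r with (INR d); [exact Hd'|]. unfold Rdiv. rewrite Rmult_assoc, Rinv_l by lra.
        rewrite Rmult_1_r, Rmult_1_l. apply lt_INR. exact Hr. }
    assert (G := Cgeom_sum w d).
    assert (Hwd : w ^ d = 1).
    { unfold w. rewrite q_pow, <- RtoC_mult. replace (INR d * (INR s / INR d))%R with (INR s) by (field; lra). apply q_nat. }
    rewrite Hwd in G.
    set (S := Csum (fun j => w ^ j) (seq 0 d)) in *.
    transitivity (/ (w - 1) * ((w - 1) * S)); [field; exact Hw|].
    rewrite G. ring.
Qed.

Lemma fourier_bounded f a y : fourier f a -> (0 < y)%R ->
  exists B, (0 <= B)%R /\ forall n, (Cmod (a n) * exp (- (2 * PI * y)) ^ n <= B)%R.
Proof.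
  intros Hf Hy. assert (H := Hf (0%R, y) Hy).
  set (u := fun n => a n * q (0%R, y) ^ n) in *.
  assert (Hu : forall n, Cmod (u n) = (Cmod (a n) * exp (- (2 * PI * y)) ^ n)%R).
  { intros n. unfold u. now rewrite Cmod_mult, Cmod_pow, Cmod_q. }
  apply cseries_iff in H. destruct H as [H1 H2].
  assert (L1 := ex_series_lim_0 _ (ex_intro _ _ H1)).
  assert (L2 := ex_series_lim_0 _ (ex_intro _ _ H2)).
  apply is_lim_seq_Reals in L1, L2.
  destruct (maj_by_pos _ (exist _ _ L1)) as [B1 [P1 Q1]].
  destruct (maj_by_pos _ (exist _ _ L2)) as [B2 [P2 Q2]].
  exists (B1 + B2)%R. split; [lra|]. intros n. rewrite <- Hu.
  eapply Rle_trans; [apply Cmod_le_abs|]. apply Rplus_le_compat; auto.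
Qed.

Lemma exp_neg_lt_1 y : (0 < y)%R -> (0 < exp (- (2 * PI * y)) < 1)%R.
Proof.
  intros Hy. split; [apply exp_pos|]. rewrite <- exp_0. apply exp_increasing.
  assert (H := PI_RGT_0). nra.
Qed.

Lemma exp_half y : (exp (- (2 * PI * y)) = exp (- (2 * PI * (y / 2))) * exp (- (2 * PI * (y / 2))))%R.
Proof. rewrite <- exp_plus. f_equal. field. Qed.

(** Abel's argument: convergence at height [y / 2] bounds the terms there, and doubling the height
    brings in another factor [r ^ n] with [r < 1]. *)
Lemma fourier_abs f a y : fourier f a -> (0 < y)%R ->
  ex_series (fun n => Cmod (a n) * exp (- (2 * PI * y)) ^ n)%R.
Proof.
  intros Hf Hy. destruct (fourier_bounded f a (y / 2) Hf ltac:(lra)) as [B [HB0 HB]].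
  assert (Hr := exp_neg_lt_1 (y / 2) ltac:(lra)).
  rewrite exp_half. set (r := exp (- (2 * PI * (y / 2)))) in *.
  apply (ex_series_le (K := R_AbsRing) (V := R_CompleteNormedModule) _ (fun n => B * r ^ n)%R).
  - intros n. unfold norm; simpl. unfold abs; simpl. rewrite Rabs_pos_eq.
    + rewrite Rpow_mult_distr, <- Rmult_assoc. apply Rmult_le_compat_r; [apply pow_le; lra|apply HB].
    + apply Rmult_le_pos; [apply Cmod_ge_0|]. apply pow_le. nra.
  - apply (ex_series_scal_l B (fun n => r ^ n)%R). apply ex_series_geom. rewrite Rabs_pos_eq; lra.
Qed.

Lemma fourier_abs_at f a z : fourier f a -> upper z -> ex_series (fun n => Cmod (a n * q z ^ n)).
Proof.
  intros Hf Hz. refine (ex_series_ext _ _ _ (fourier_abs f a (Im z) Hf Hz)).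
  intros n. now rewrite Cmod_mult, Cmod_pow, Cmod_q.
Qed.

Lemma pow_antitone r m n : (0 <= r <= 1)%R -> (n <= m)%nat -> (r ^ m <= r ^ n)%R.
Proof.
  intros Hr H. replace m with (n + (m - n))%nat by lia. rewrite pow_add.
  assert (H1 : (r ^ (m - n) <= 1)%R) by (rewrite <- (pow1 (m - n)); apply pow_incr; lra).
  assert (H2 : (0 <= r ^ n)%R) by (apply pow_le; lra). nra.
Qed.

Lemma cseries_single n (c : C) : cseries (fun m => if Nat.eqb m n then c else RtoC 0) c.
Proof.
  set (u := fun m => if Nat.eqb m n then c else RtoC 0).
  assert (H0 : forall m, (m < n)%nat -> sum_n (G := C_AbelianMonoid) u m = RtoC 0).
  { induction m as [|m IH]; intros Hm.
    - rewrite sum_O. unfold u. destruct (Nat.eqb_spec 0 n); [lia|reflexivity].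
    - rewrite sum_Sn, IH by lia. unfold u. destruct (Nat.eqb_spec (S m) n); [lia|].
      apply (plus_zero_l (G := C_AbelianGroup)). }
  unfold is_series. apply (filterlim_ext_loc (fun _ => c)); [|apply filterlim_const].
  exists n. intros m Hm. induction Hm as [|m Hm IH].
  - destruct n as [|n].
    + now rewrite sum_O.
    + rewrite sum_Sn, H0 by lia. unfold u. rewrite Nat.eqb_refl.
      symmetry. apply (plus_zero_l (G := C_AbelianGroup)).
  - rewrite sum_Sn, <- IH. unfold u. destruct (Nat.eqb_spec (S m) n); [lia|].
    symmetry. apply (plus_zero_r (G := C_AbelianGroup)).
Qed.

(** Averaging [f] over [L] equidistant points of the horizontal line at height [y], against
    a character of order [L], isolates the coefficients of index congruent to [n] modulo
    [L]; all of them except the [n]-th disappear as [L] grows. *)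
Lemma fourier_coef_le f a y B n : fourier f a -> (0 < y)%R ->
  (forall x, (Cmod (f (x, y)) <= B)%R) ->
  (Cmod (a n) * exp (- (2 * PI * y)) ^ n <= B)%R.
Proof.
  intros Hf Hy HB.
  destruct (fourier_abs f a (y / 2) Hf ltac:(lra)) as [X HX].
  assert (Hr := exp_neg_lt_1 (y / 2) ltac:(lra)).
  assert (Hrr := exp_half y).
  set (r := exp (- (2 * PI * (y / 2)))) in *.
  assert (HX0 : (0 <= X)%R).
  { refine (is_series_le (fun _ => 0%R) _ _ _ _ (proj1 (proj1 (cseries_iff _ _) cseries_zero)) HX).
    intros m. apply Rmult_le_pos; [apply Cmod_ge_0|apply pow_le; lra]. }
  (* An index [m <> n] congruent to [n] modulo [L > n] is at least [L]. At height [y] it carries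
     [r^(2m) <= r^L * r^m], so all of them together cost at most [r^L * X], with [X] the absolute
     sum at height [y / 2]. *)
  assert (HL : forall L, (n < L)%nat -> (Cmod (a n) * exp (- (2 * PI * y)) ^ n <= B + r ^ L * X)%R).
  { intros L HnL. assert (HLp : (0 < INR L)%R) by (apply lt_0_INR; lia).
    set (e := fun j => q (RtoC (INR j / INR L))).
    set (zj := fun j : nat => ((INR j / INR L)%R, y) : C).
    assert (Hqz : forall j, q (zj j) = e j * q (0%R, y)).
    { intros j. unfold e. rewrite <- q_plus. f_equal. unfold zj, RtoC, Cplus; simpl. f_equal; ring. }
    (* Since [e j] is an [L]-th root of unity, the exponent [L - n] stands for [-n]. *)
    set (s := Csum (fun j => e j ^ (L - n) * f (zj j)) (seq 0 L)).
    assert (Hs : (Cmod s <= INR L * B)%R).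
    { unfold s. rewrite <- (length_seq L 0) at 2. apply Cmod_Csum_le. intros j _.
      rewrite Cmod_mult, Cmod_pow. unfold e. rewrite Cmod_q, im_RtoC, Rmult_0_r, Ropp_0, exp_0, pow1, Rmult_1_l.
      apply HB. }
    assert (Hser : cseries (fun m => Csum (fun j => e j ^ (L - n) * (a m * q (zj j) ^ m)) (seq 0 L)) s).
    { apply (cseries_Csum _ (fun j m => e j ^ (L - n) * (a m * q (zj j) ^ m))). intros j _. apply cseries_scal. apply Hf. exact Hy. }
    apply (cseries_scal (/ RtoC (INR L))) in Hser.
    assert (HLC : RtoC (INR L) <> 0) by (intros E; injection E as E; lra).
    set (w := q (0%R, y)) in *.
    assert (Hser2 : cseries (fun m => a m * w ^ m * (if Nat.eqb ((L - n + m) mod L) 0 then RtoC 1 else RtoC 0)) (/ RtoC (INR L) * s)).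
    { refine (cseries_ext _ _ _ _ Hser). intros m. cbv beta.
      rewrite (Csum_ext _ _ (fun j => (a m * w ^ m) * e j ^ (L - n + m))).
      - rewrite Csum_scal. unfold e. rewrite q_average by lia.
        destruct (Nat.eqb _ _); [field; exact HLC|ring].
      - intros j _. rewrite Hqz, Cpow_mult_l, Cpow_add_r. ring. }
    set (v := fun m : nat => a m * w ^ m * (if Nat.eqb ((L - n + m) mod L) 0 then RtoC 1 else RtoC 0)
      + RtoC (-1)%R * (if Nat.eqb m n then a n * w ^ n else RtoC 0)).
    assert (Hsub : cseries v (/ RtoC (INR L) * s + RtoC (-1)%R * (a n * w ^ n))).
    { exact (cseries_plus _ _ _ _ Hser2 (cseries_scal (RtoC (-1)%R) _ _ (cseries_single n (a n * w ^ n)))). }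
    assert (Hbd : (Cmod (/ RtoC (INR L) * s + RtoC (-1)%R * (a n * w ^ n)) <= r ^ L * X)%R).
    { refine (cseries_Cmod_le _ _ _ _ _ Hsub (is_series_scal_l (r ^ L)%R _ _ HX)).
      intros m. change (Cmod (v m) <= r ^ L * (Cmod (a m) * r ^ m))%R. unfold v.
      assert (Hpos : (0 <= r ^ L * (Cmod (a m) * r ^ m))%R).
      { apply Rmult_le_pos; [apply pow_le; lra|]. apply Rmult_le_pos; [apply Cmod_ge_0|apply pow_le; lra]. }
      destruct (Nat.eqb_spec m n) as [->|Hmn].
      - replace (L - n + n)%nat with L by lia. rewrite Nat.Div0.mod_same. rewrite Nat.eqb_refl.
        replace (_ + _) with (RtoC 0) by ring. rewrite Cmod_0. exact Hpos.
      - destruct (Nat.eqb_spec ((L - n + m) mod L) 0) as [E|E].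
        + apply Nat.Div0.div_exact in E.
          assert (HmL : (L <= m)%nat).
          { set (t := ((L - n + m) / L)%nat) in *.
            destruct (Nat.le_gt_cases t 1) as [Ht|Ht]; [|nia].
            destruct t as [|[|t]]; lia. }
          replace (_ + _) with (a m * w ^ m) by ring.
          rewrite Cmod_mult, Cmod_pow. unfold w. rewrite Cmod_q. unfold Im; simpl snd. rewrite Hrr.
          rewrite Rpow_mult_distr.
          assert (Hrm : (r ^ m <= r ^ L)%R).
          { apply pow_antitone; [lra|exact HmL]. }
          assert (0 <= r ^ m)%R by (apply pow_le; lra).
          assert (H0 := Cmod_ge_0 (a m)).
          replace (r ^ L * (Cmod (a m) * r ^ m))%R with (Cmod (a m) * (r ^ L * r ^ m))%R by ring.
          apply Rmult_le_compat_l; [exact H0|]. now apply Rmult_le_compat_r.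
        + replace (_ + _) with (RtoC 0) by ring. rewrite Cmod_0. exact Hpos. }
    assert (Hw : (Cmod (a n) * exp (- (2 * PI * y)) ^ n)%R = Cmod (a n * w ^ n)).
    { unfold w. now rewrite Cmod_mult, Cmod_pow, Cmod_q. }
    rewrite Hw. replace (a n * w ^ n) with (/ RtoC (INR L) * s + - (/ RtoC (INR L) * s + RtoC (-1)%R * (a n * w ^ n))) by ring.
    eapply Rle_trans; [apply Cmod_triangle|]. rewrite Cmod_opp. apply Rplus_le_compat; [|exact Hbd].
    rewrite Cmod_mult, Cmod_inv by exact HLC. rewrite Cmod_INR.
    apply Rmult_le_reg_l with (INR L); [exact HLp|]. rewrite <- Rmult_assoc, Rinv_r by lra. lra. }
  set (T := (Cmod (a n) * exp (- (2 * PI * y)) ^ n)%R) in *.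
  assert (Lim : is_lim_seq (fun L => B + r ^ L * X)%R (B + 0 * X)%R).
  { apply is_lim_seq_plus'; [apply is_lim_seq_const|].
    apply is_lim_seq_mult'; [|apply is_lim_seq_const]. apply is_lim_seq_geom. rewrite Rabs_pos_eq; lra. }
  replace B with (B + 0 * X)%R by ring.
  refine (is_lim_seq_le_loc (fun _ => T) _ T _ _ (is_lim_seq_const T) Lim).
  exists (S n). intros L HL'. apply HL. lia.
Qed.

Lemma fourier_ext f g a : (forall z, upper z -> f z = g z) -> fourier f a -> fourier g a.
Proof. intros H Hf z Hz. rewrite <- H by exact Hz. now apply Hf. Qed.

Lemma fourier_scal f a c : fourier f a -> fourier (fun z => c * f z) (fun n => c * a n).
Proof.
  intros Hf z Hz. refine (cseries_ext _ _ _ _ (cseries_scal c _ _ (Hf z Hz))).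
  intros n. cbv beta. ring.
Qed.

Lemma fourier_Csum (T : Type) (f : T -> C -> C) (a : T -> nat -> C) l :
  (forall x, In x l -> fourier (f x) (a x)) ->
  fourier (fun z => Csum (fun x => f x z) l) (fun n => Csum (fun x => a x n) l).
Proof.
  intros H z Hz.
  refine (cseries_ext _ _ _ _ (cseries_Csum _ (fun x n => a x n * q z ^ n) _ l _)).
  - intros n. cbv beta. rewrite (Csum_ext _ _ (fun x => q z ^ n * a x n)) by (intros; ring).
    rewrite Csum_scal. ring.
  - intros x Hx. now apply H.
Qed.

Lemma fourier_mult f g a b : fourier f a -> fourier g b -> fourier (fun z => f z * g z) (conv a b).
Proof.
  intros Hf Hg z Hz.
  refine (cseries_ext _ _ _ _ (cseries_conv _ _ _ _ (Hf z Hz) (Hg z Hz)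
    (fourier_abs_at _ _ _ Hf Hz) (fourier_abs_at _ _ _ Hg Hz))).
  intros n. unfold conv.
  rewrite (Csum_ext _ _ (fun j => q z ^ n * (a j * b (n - j)%nat))).
  - rewrite Csum_scal. ring.
  - intros j Hj. apply in_seq in Hj.
    transitivity (a j * b (n - j)%nat * (q z ^ j * q z ^ (n - j))); [ring|].
    rewrite <- Cpow_add_r. replace (j + (n - j))%nat with n by lia. ring.
Qed.

Definition conv_unit (n : nat) : C := if Nat.eqb n 0 then 1 else 0.

Lemma fourier_one : fourier (fun _ => RtoC 1) conv_unit.
Proof.
  intros z Hz. refine (cseries_ext _ _ _ _ (cseries_single 0 (RtoC 1))).
  intros n. unfold conv_unit. destruct n; simpl; ring.
Qed.

(** The difference of the two expansions represents zero, so the coefficient estimate applies to it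
    with bound 0. *)
Lemma fourier_unique f g a b :
  fourier f a -> fourier g b -> (forall z, upper z -> f z = g z) -> forall n, a n = b n.
Proof.
  intros Hf Hg E n.
  assert (H : fourier (fun _ => RtoC 0) (fun n => a n + RtoC (-1) * b n)).
  { intros z Hz.
    replace (RtoC 0) with (f z + RtoC (-1) * g z) by (rewrite E by exact Hz; ring).
    refine (cseries_ext _ _ _ _ (cseries_plus _ _ _ _ (Hf z Hz) (cseries_scal (RtoC (-1)) _ _ (Hg z Hz)))).
    intros m. cbv beta. ring. }
  assert (H1 : (Cmod (a n + RtoC (-1) * b n) * exp (- (2 * PI * 1)) ^ n <= 0)%R).
  { apply (fourier_coef_le _ _ 1 0 n H Rlt_0_1). intros x. rewrite Cmod_0. apply Rle_refl. } set (t := a n + RtoC (-1) * b n) in *.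
  assert (Ht : t = 0).
  { apply Cmod_eq_0. assert (H2 := Cmod_ge_0 t).
    assert (H3 := pow_lt _ n (exp_pos (- (2 * PI * 1)))). nra. }
  apply Ceq_minus. rewrite <- Ht. unfold t. ring.
Qed.

(** * The invariant norm of a cusp form *)

Definition automorphic (k : nat) (f : C -> C) : Prop :=
  forall (a b c d : Z) (z : C), (a * d - b * c = 1)%Z -> upper z ->
     f ((RtoC (IZR a) * z + RtoC (IZR b)) / (RtoC (IZR c) * z + RtoC (IZR d)))
     = (RtoC (IZR c) * z + RtoC (IZR d)) ^ k * f z.

(** This is [|f(z)| Im(z)^(k/2)], which is invariant under the modular group when [f] has weight
    [k]; the square root avoids half-integral exponents. *)
Definition inv_norm (k : nat) (f : C -> C) (z : C) : R := (Cmod (f z) * sqrt (Im z) ^ k)%R.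

Lemma upper_neq_0 z : upper z -> z <> 0.
Proof. intros Hz ->. unfold upper in Hz. simpl in Hz. lra. Qed.

Lemma upper_Cmod z : upper z -> (0 < Cmod z)%R.
Proof. intros Hz. now apply Cmod_gt_0, upper_neq_0. Qed.

Lemma Cmod_sqr z : (Cmod z ^ 2 = Re z ^ 2 + Im z ^ 2)%R.
Proof. unfold Cmod. rewrite pow2_sqrt; [reflexivity|]. unfold Re, Im. nra. Qed.

Lemma Im_neg_inv z : upper z -> (Im (- / z) = Im z / Cmod z ^ 2)%R.
Proof.
  intros Hz. rewrite Cmod_sqr. destruct z as [x y]. unfold upper, Im in Hz. simpl in Hz.
  unfold Cinv, Copp, Im, Re. simpl. field. nra.
Qed.

Lemma automorphic_translate k f b z : automorphic k f -> upper z -> f (z + RtoC (IZR b)) = f z.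
Proof.
  intros Hf Hz. assert (H := Hf 1%Z b 0%Z 1%Z z ltac:(lia) Hz).
  replace ((RtoC (IZR 1) * z + RtoC (IZR b)) / (RtoC (IZR 0) * z + RtoC (IZR 1))) with (z + RtoC (IZR b)) in H.
  - rewrite H. replace (RtoC (IZR 0) * z + RtoC (IZR 1)) with (RtoC 1) by ring.
    rewrite Cpow_1_l. ring.
  - replace (RtoC (IZR 0) * z + RtoC (IZR 1)) with (RtoC 1) by ring. field.
Qed.

Lemma automorphic_neg_inv k f z : automorphic k f -> upper z -> f (- / z) = z ^ k * f z.
Proof.
  intros Hf Hz. assert (H := Hf 0%Z (-1)%Z 1%Z 0%Z z ltac:(lia) Hz).
  replace ((RtoC (IZR 0) * z + RtoC (IZR (-1))) / (RtoC (IZR 1) * z + RtoC (IZR 0))) with (- / z) in H.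
  - rewrite H. f_equal. f_equal. ring.
  - replace (RtoC (IZR 1) * z + RtoC (IZR 0)) with z by ring.
    assert (Hz0 := upper_neq_0 z Hz). field. exact Hz0.
Qed.

Lemma inv_norm_neg_inv k f z : automorphic k f -> upper z -> inv_norm k f (- / z) = inv_norm k f z.
Proof.
  intros Hf Hz. unfold inv_norm. rewrite (automorphic_neg_inv k f z Hf Hz), Im_neg_inv by exact Hz.
  assert (Hc := upper_Cmod z Hz).
  rewrite sqrt_div_alt by (apply pow_lt; exact Hc). rewrite sqrt_pow2 by lra.
  unfold Rdiv. rewrite Rpow_mult_distr, pow_inv, Cmod_mult, Cmod_pow.
  field. apply pow_nonzero. lra.
Qed.

(** Translating to [|Re z| <= 1/2] and inverting at least doubles the imaginary part as long
    as it is below [1/2]. *)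
Lemma automorphic_reduce k f : automorphic k f -> forall n z, upper z -> (/ 2 ^ n <= Im z)%R ->
  exists z', (1 / 2 <= Im z')%R /\ inv_norm k f z' = inv_norm k f z.
Proof.
  intros Hf. induction n as [|n IH]; intros z Hz Hn.
  - exists z. split; [simpl in Hn; lra|reflexivity].
  - destruct (Rle_lt_dec (1 / 2) (Im z)) as [H|H]; [exists z; auto|].
    (* As [up x] lies in the interval from [x] to [x + 1], this translation brings the real part
       between -1/2 and 1/2; then [|w|^2 <= 1/4 + 1/4]. *)
    set (b := (- up (Re z - 1 / 2))%Z). set (w := z + RtoC (IZR b)).
    destruct (archimed (Re z - 1 / 2)) as [U1 U2].
    assert (Hw : Im w = Im z) by (unfold w, Im, Cplus, RtoC; simpl; ring).
    assert (Hwr : (- (1 / 2) <= Re w <= 1 / 2)%R).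
    { unfold w, b, Re, Cplus, RtoC in *; simpl. rewrite opp_IZR. lra. }
    assert (Hwu : upper w) by (unfold upper; rewrite Hw; exact Hz).
    assert (Hwz : inv_norm k f w = inv_norm k f z).
    { unfold inv_norm. rewrite Hw. unfold w. now rewrite (automorphic_translate k f b z Hf Hz). }
    assert (Hc := upper_Cmod w Hwu).
    assert (Hs : (0 < Cmod w ^ 2 <= 1 / 2)%R).
    { split; [apply pow_lt; exact Hc|]. rewrite Cmod_sqr, Hw. unfold upper in Hz. nra. }
    assert (HI : (2 * Im z <= Im (- / w))%R).
    { rewrite Im_neg_inv, Hw by exact Hwu. unfold upper in Hz.
      apply Rmult_le_reg_r with (Cmod w ^ 2)%R; [lra|]. replace (Im z / Cmod w ^ 2 * Cmod w ^ 2)%R with (Im z) by (field; lra). nra. }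
    destruct (IH (- / w)) as [z' [H1 H2]].
    + unfold upper in *. lra.
    + simpl in Hn. rewrite Rinv_mult in Hn. lra.
    + exists z'. split; [exact H1|]. rewrite H2, inv_norm_neg_inv; auto.
Qed.

(** The region [Im z >= 1/2] contains the usual fundamental domain. With this lower threshold every
    inversion gains a factor 2, so the reduction stops after a number of steps read off from
    [Im z]. *)
Lemma inv_norm_le_of_high k f M : automorphic k f ->
  (forall z, (1 / 2 <= Im z)%R -> (inv_norm k f z <= M)%R) ->
  forall z, upper z -> (inv_norm k f z <= M)%R.
Proof.
  intros Hf HM z Hz.
  assert (Hn : exists n, (/ 2 ^ n <= Im z)%R).
  { destruct (pow_lt_1_zero (/ 2) ltac:(rewrite Rabs_pos_eq; lra) (Im z) Hz) as [n Hn].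
    exists n. specialize (Hn n (Nat.le_refl n)). rewrite <- pow_inv. apply Rabs_def2 in Hn. lra. }
  destruct Hn as [n Hn].
  destruct (automorphic_reduce k f Hf n z Hz Hn) as [z' [H1 <-]]. now apply HM.
Qed.

Lemma pow_div_fact_le_exp x n : (0 <= x)%R -> (x ^ n / INR (fact n) <= exp x)%R.
Proof.
  intros Hx. eapply Rle_trans; [|apply (exp_ge_taylor x n Hx)].
  destruct n as [|n]; [simpl; lra|].
  rewrite tech5. assert (0 <= sum_f_R0 (fun k => x ^ k / INR (fact k)) n)%R; [|lra].
  apply cond_pos_sum. intros k. apply Rmult_le_pos; [now apply pow_le|].
  apply Rlt_le, Rinv_0_lt_compat, INR_fact_lt_0.
Qed.

Lemma exp_neg_le y y' : (y <= y')%R -> (exp (- (2 * PI * y')) <= exp (- (2 * PI * y)))%R.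
Proof.
  intros H. assert (HP := PI_RGT_0).
  destruct (Rle_lt_or_eq_dec _ _ H) as [H1| ->]; [|apply Rle_refl].
  apply Rlt_le, exp_increasing. nra.
Qed.

(** Only [Im z = y >= 1/2] matters. There the missing constant term gives [|f(z)| <= r X], with
    [r = exp(-pi y)] and [X] the absolute sum at height 1/4, half the least height. The exponential
    wins over [y^(k/2)] through [y^(k/2) <= (1+y)^k <= k! exp(1+y)]. *)
Lemma cusp_inv_norm_bounded k f a : automorphic k f -> fourier f a -> a 0%nat = 0 ->
  exists M, (0 <= M)%R /\ forall z, upper z -> (inv_norm k f z <= M)%R.
Proof.
  intros Hf Ha Ha0. destruct (fourier_abs f a (1 / 4) Ha ltac:(lra)) as [X HX].
  set (rho := exp (- (2 * PI * (1 / 4)))) in *.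
  assert (Hrho : (0 < rho < 1)%R) by (apply exp_neg_lt_1; lra).
  assert (HX0 : (0 <= X)%R).
  { refine (is_series_le (fun _ => 0%R) _ _ _ _ (proj1 (proj1 (cseries_iff _ _) cseries_zero)) HX).
    intros m. apply Rmult_le_pos; [apply Cmod_ge_0|apply pow_le; lra]. }
  assert (HF : (0 < INR (fact k))%R) by apply INR_fact_lt_0.
  exists (X * (INR (fact k) * exp 1))%R.
  split; [apply Rmult_le_pos; [exact HX0|]; apply Rmult_le_pos; [lra|apply Rlt_le, exp_pos]|].
  apply inv_norm_le_of_high; [exact Hf|]. intros z Hz.
  assert (Hzu : upper z) by (unfold upper; lra).
  set (y := Im z) in *. set (r := exp (- (2 * PI * (y / 2)))).
  assert (Hr : (0 < r < 1)%R) by (apply exp_neg_lt_1; lra).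
  assert (Hrr : (r <= rho)%R) by (apply exp_neg_le; lra).
  assert (Hfz : (Cmod (f z) <= r * X)%R).
  { refine (cseries_Cmod_le _ _ _ _ _ (Ha z Hzu) (is_series_scal_l r _ _ HX)).
    intros n. change (Cmod (a n * q z ^ n) <= r * (Cmod (a n) * rho ^ n))%R.
    rewrite Cmod_mult, Cmod_pow, Cmod_q. fold y. rewrite exp_half. fold r.
    destruct n as [|n]; [rewrite Ha0, Cmod_0; lra|].
    rewrite Rpow_mult_distr.
    assert (H1 : (r ^ S n <= rho ^ S n)%R) by (apply pow_incr; lra).
    assert (H2 : (r ^ S n <= r)%R) by (rewrite <- (pow_1 r) at 2; apply pow_antitone; [lra|lia]).
    assert (H3 : (0 <= r ^ S n)%R) by (apply pow_le; lra).
    assert (H4 := Cmod_ge_0 (a (S n))).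
    replace (r * (Cmod (a (S n)) * rho ^ S n))%R with (Cmod (a (S n)) * (r * rho ^ S n))%R by ring.
    apply Rmult_le_compat_l; [exact H4|]. apply Rmult_le_compat; lra. }
  assert (Hy : (r * sqrt y ^ k <= INR (fact k) * exp 1)%R).
  { assert (H1 : (sqrt y ^ k <= (1 + y) ^ k)%R).
    { apply pow_incr. split; [apply sqrt_pos|].
      assert (H2 := sqrt_sqrt y ltac:(lra)). assert (H3 := sqrt_pos y). nra. }
    assert (H2 := pow_div_fact_le_exp (1 + y) k ltac:(lra)).
    assert (H3 : ((1 + y) ^ k <= INR (fact k) * exp (1 + y))%R).
    { apply Rmult_le_reg_r with (/ INR (fact k))%R; [now apply Rinv_0_lt_compat|].
      replace (INR (fact k) * exp (1 + y) * / INR (fact k))%R with (exp (1 + y)) by (field; lra). exact H2. }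
    assert (H4 : (r * exp (1 + y) <= exp 1)%R).
    { unfold r. rewrite <- exp_plus. assert (HP := PI2_3_2).
      assert (H5 : (- (2 * PI * (y / 2)) + (1 + y) <= 1)%R) by nra.
      destruct (Rle_lt_or_eq_dec _ _ H5) as [H6| ->]; [|apply Rle_refl]. now apply Rlt_le, exp_increasing. }
    apply Rle_trans with (r * (INR (fact k) * exp (1 + y)))%R.
    - apply Rmult_le_compat_l; lra.
    - replace (r * (INR (fact k) * exp (1 + y)))%R with (INR (fact k) * (r * exp (1 + y)))%R by ring.
      apply Rmult_le_compat_l; lra. }
  unfold inv_norm. fold y.
  apply Rle_trans with (r * X * sqrt y ^ k)%R.
  - apply Rmult_le_compat_r; [apply pow_le, sqrt_pos|exact Hfz].
  - replace (r * X * sqrt y ^ k)%R with (X * (r * sqrt y ^ k))%R by ring.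
    now apply Rmult_le_compat_l.
Qed.

Lemma is_series_geom_tail (x : R) N : (0 <= x < 1)%R ->
  is_series (fun n => if Nat.ltb n N then 0%R else (x ^ n)%R) (x ^ N / (1 - x))%R.
Proof.
  intros Hx. induction N as [|N IH].
  - simpl. replace (1 / (1 - x))%R with (/ (1 - x))%R by (field; lra).
    apply is_series_geom. rewrite Rabs_pos_eq; lra.
  - apply is_series_decr_1.
    match goal with |- is_series _ ?l => assert (E : l = scal x (x ^ N / (1 - x))%R) end.
    { change (x ^ S N / (1 - x) + - 0 = x * (x ^ N / (1 - x)))%R. simpl. field. lra. }
    rewrite E. refine (is_series_ext _ _ _ _ (is_series_scal_l x _ _ IH)).
    intros n. change (x * (if Nat.ltb n N then 0 else x ^ n) = if Nat.ltb n N then 0 else x ^ S n)%R.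
    destruct (Nat.ltb n N); simpl; ring.
Qed.

(** Iterating the improvement gives the bounds [c^j M], which tend to 0. Improving an arbitrary
    bound takes the place of evaluating at a maximum point, and thus of compactness. *)
Lemma inv_norm_contract k f c M : (0 <= c < 1)%R -> (0 <= M)%R ->
  (forall z, upper z -> (inv_norm k f z <= M)%R) ->
  (forall M', (0 <= M')%R -> (forall z, upper z -> (inv_norm k f z <= M')%R) ->
    forall z, upper z -> (inv_norm k f z <= c * M')%R) ->
  forall z, upper z -> f z = 0.
Proof.
  intros Hc HM0 HM Step.
  assert (Iter : forall j z, upper z -> (inv_norm k f z <= c ^ j * M)%R).
  { induction j as [|j IH]; intros z Hz.
    - simpl. rewrite Rmult_1_l. now apply HM.
    - simpl. rewrite Rmult_assoc. apply Step; auto.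
      apply Rmult_le_pos; [now apply pow_le|exact HM0]. }
  intros z Hz.
  assert (H0 : (inv_norm k f z <= 0)%R).
  { replace 0%R with (0 * M)%R by ring.
    apply (is_lim_seq_le (fun _ => inv_norm k f z) (fun j => c ^ j * M)%R (inv_norm k f z) (0 * M)%R).
    - intros j. now apply Iter.
    - apply is_lim_seq_const.
    - apply is_lim_seq_mult'; [apply is_lim_seq_geom; rewrite Rabs_pos_eq; lra|apply is_lim_seq_const]. }
  unfold inv_norm in H0. assert (Hs : (0 < sqrt (Im z) ^ k)%R) by (apply pow_lt, sqrt_lt_R0, Hz).
  apply Cmod_eq_0. assert (H1 := Cmod_ge_0 (f z)). nra.
Qed.

(** By Cauchy's estimate at height [y / 2], a bound [M] for the invariant norm of a form
    vanishing to order [N] at infinity improves to [c M]. *)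
Lemma automorphic_vanish k f a N :
  automorphic k f -> fourier f a -> (1 <= N)%nat -> (forall n, (n < N)%nat -> a n = 0) ->
  (sqrt 2 ^ k * ((2 / 5) ^ N * (5 / 3)) < 1)%R ->
  forall z, upper z -> f z = 0.
Proof.
  (* The factor [sqrt 2 ^ k] is the price of comparing the invariant norm at heights [y] and
     [y / 2]; the rest is the geometric tail from [N] on with ratio 2/5, where
     [5/3 = 1 / (1 - 2/5)]. *)
  intros Hf Ha HN Hv Hc. set (c := (sqrt 2 ^ k * ((2 / 5) ^ N * (5 / 3)))%R) in *.
  assert (Hc0 : (0 <= c)%R).
  { apply Rmult_le_pos; [apply pow_le, sqrt_pos|]. assert (0 <= (2 / 5) ^ N)%R by (apply pow_le; lra). lra. }
  assert (Step : forall M, (0 <= M)%R -> (forall z, upper z -> (inv_norm k f z <= M)%R) ->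
    forall z, upper z -> (inv_norm k f z <= c * M)%R).
  { intros M HM0 HM. apply inv_norm_le_of_high; [exact Hf|]. intros z Hz.
    assert (Hzu : upper z) by (unfold upper; lra).
    set (y := Im z) in *. set (r := exp (- (2 * PI * (y / 2)))).
    assert (Hr : (0 < r < 1)%R) by (apply exp_neg_lt_1; lra).
    (* For [y >= 1/2], [r <= exp(-pi/2)], and [exp(pi/2) >= 1 + pi/2 >= 5/2]. *)
    assert (Hr5 : (r <= 2 / 5)%R).
    { apply Rle_trans with (exp (- (2 * PI * (1 / 4)))); [apply exp_neg_le; lra|].
      rewrite exp_Ropp. assert (HP := PI2_3_2).
      assert (H1 := exp_ineq1 (2 * PI * (1 / 4)) ltac:(lra)).
      apply Rle_trans with (/ (5 / 2))%R; [|lra]. apply Rinv_le_contravar; lra. }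
    assert (Hs : (0 < sqrt (y / 2) ^ k)%R) by (apply pow_lt, sqrt_lt_R0; lra).
    set (M' := (M / sqrt (y / 2) ^ k)%R).
    assert (HM' : (0 <= M')%R) by (apply Rmult_le_pos; [exact HM0|apply Rlt_le, Rinv_0_lt_compat, Hs]).
    assert (Hcoef : forall n, (Cmod (a n) * r ^ n <= M')%R).
    { intros n. apply (fourier_coef_le f a (y / 2) M' n Ha ltac:(lra)). intros x.
      assert (H1 := HM (x, (y / 2)%R) ltac:(unfold upper; simpl; lra)).
      unfold inv_norm in H1. simpl Im in H1. unfold M'.
      apply Rmult_le_reg_r with (sqrt (y / 2) ^ k)%R; [exact Hs|].
      replace (M / sqrt (y / 2) ^ k * sqrt (y / 2) ^ k)%R with M by (field; lra). exact H1. }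
    assert (Hfz : (Cmod (f z) <= M' * ((2 / 5) ^ N / (1 - 2 / 5)))%R).
    { refine (cseries_Cmod_le _ _ _ _ _ (Ha z Hzu) (is_series_scal_l M' _ _ (is_series_geom_tail (2 / 5) N ltac:(lra)))).
      intros n. change (Cmod (a n * q z ^ n) <= M' * (if Nat.ltb n N then 0%R else ((2 / 5) ^ n)%R))%R.
      rewrite Cmod_mult, Cmod_pow, Cmod_q. fold y. rewrite exp_half. fold r.
      destruct (Nat.ltb_spec n N) as [H|H]; [rewrite Hv, Cmod_0 by exact H; lra|].
      rewrite Rpow_mult_distr, <- Rmult_assoc. apply Rmult_le_compat.
      - apply Rmult_le_pos; [apply Cmod_ge_0|apply pow_le; lra].
      - apply pow_le; lra.
      - apply Hcoef.
      - apply pow_incr; lra. }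
    unfold inv_norm. fold y.
    apply Rle_trans with (M' * ((2 / 5) ^ N / (1 - 2 / 5)) * sqrt y ^ k)%R.
    - apply Rmult_le_compat_r; [apply pow_le, sqrt_pos|exact Hfz].
    - right. unfold M', c.
      replace (sqrt y) with (sqrt 2 * sqrt (y / 2))%R by (rewrite <- sqrt_mult by lra; f_equal; field).
      rewrite Rpow_mult_distr. field. lra. }
  destruct (cusp_inv_norm_bounded k f a Hf Ha (Hv 0%nat HN)) as [M [HM0 HM]].
  apply (inv_norm_contract k f c M); auto.
Qed.

(** * Hecke operators on Fourier coefficients *)

Lemma in_divisors d n : In d (divisors n) <-> (1 <= d <= n)%nat /\ (n mod d = 0)%nat.
Proof.
  unfold divisors. rewrite filter_In, in_seq, Nat.eqb_eq. lia.
Qed.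

Lemma divisors_NoDup n : NoDup (divisors n).
Proof. apply NoDup_filter, seq_NoDup. Qed.

Lemma divisors_length n : (length (divisors n) <= n)%nat.
Proof. unfold divisors. rewrite <- (length_seq n 1) at 2. apply filter_length_le. Qed.

Lemma RtoC_INR_neq_0 n : (1 <= n)%nat -> RtoC (INR n) <> 0.
Proof. intros H E. injection E as E. assert (0 < INR n)%R by (apply lt_0_INR; lia). lra. Qed.

(** For [k >= 1], writing [e = n / d] gives the classical formula: the sum of [e^(k-1) a(n l / e^2)]
    over the common divisors [e] of [n] and [l]. *)
Definition hecke_coef (k n : nat) (a : nat -> C) (l : nat) : C :=
  RtoC (INR n) ^ (k - 1) *
  Csum (fun d => / RtoC (INR d) ^ k * (RtoC (INR d) * spread (n / d) (fun t => a (d * t)%nat) l))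
    (divisors n).

Lemma upper_affine (e b d : nat) z : (1 <= e)%nat -> (1 <= d)%nat -> upper z ->
  (Im ((RtoC (INR e) * z + RtoC (INR b)) / RtoC (INR d)) = INR e * Im z / INR d)%R.
Proof.
  intros He Hd Hz. assert (0 < INR d)%R by (apply lt_0_INR; lia).
  unfold Cdiv. rewrite <- RtoC_inv by lra. rewrite im_scal_r.
  unfold Im, Cplus, Cmult, RtoC; simpl. field. lra.
Qed.

Lemma fourier_average f a d e : fourier f a -> (1 <= d)%nat -> (1 <= e)%nat ->
  fourier (fun z => Csum (fun b => f ((RtoC (INR e) * z + RtoC (INR b)) / RtoC (INR d))) (seq 0 d))
    (fun l => RtoC (INR d) * spread e (fun t => a (d * t)%nat) l).
Proof.
  intros Hf Hd He z Hz.
  assert (HdR : (0 < INR d)%R) by (apply lt_0_INR; lia).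
  assert (HeR : (0 < INR e)%R) by (apply lt_0_INR; lia).
  assert (HdC := RtoC_INR_neq_0 d Hd).
  set (w := fun b : nat => (RtoC (INR e) * z + RtoC (INR b)) / RtoC (INR d)).
  set (s := Csum (fun b => f (w b)) (seq 0 d)).
  assert (H1 : cseries (fun m => Csum (fun b => a m * q (w b) ^ m) (seq 0 d)) s).
  { apply (cseries_Csum _ (fun b m => a m * q (w b) ^ m)). intros b _. apply Hf.
    unfold upper. unfold w. rewrite upper_affine by assumption.
    apply Rdiv_lt_0_compat; [apply Rmult_lt_0_compat; assumption|exact HdR]. }
  set (z0 := RtoC (INR e) * z / RtoC (INR d)).
  assert (Hq : forall b, q (w b) = q z0 * q (RtoC (INR b / INR d))).
  { intros b. rewrite <- q_plus. f_equal. unfold w, z0. rewrite RtoC_div by lra. field. exact HdC. }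
  assert (H2 : cseries (spread d (fun t => RtoC (INR d) * a (d * t)%nat * q z ^ (e * t))) s).
  { refine (cseries_ext _ _ _ _ H1). intros m. cbv beta.
    rewrite (Csum_ext _ _ (fun b => (a m * q z0 ^ m) * q (RtoC (INR b / INR d)) ^ m)).
    - rewrite Csum_scal, q_average by exact Hd. unfold spread.
      destruct (Nat.eqb_spec (m mod d) 0) as [E|E]; [|ring].
      apply Nat.Div0.div_exact in E. rewrite <- E.
      replace (q z0 ^ m) with (q z ^ (e * (m / d))); [ring|].
      rewrite !q_pow. f_equal. unfold z0. rewrite E at 2. rewrite !mult_INR, !RtoC_mult. field. exact HdC.
    - intros b _. rewrite Hq, Cpow_mult_l. ring. }
  (* The average over [b] keeps the indices [m = d t], whose terms are powers [q z ^ (e * t)]; so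
     the series is re-indexed by [t] and then placed on the multiples of [e]. *)
  apply cseries_unspread in H2; [|exact Hd].
  apply (cseries_spread e) in H2; [|exact He].
  refine (cseries_ext _ _ _ _ H2). intros l. unfold spread.
  destruct (Nat.eqb_spec (l mod e) 0) as [E|E]; [|ring].
  apply Nat.Div0.div_exact in E. now rewrite <- E.
Qed.

Lemma divisor_quotient d n : In d (divisors n) -> (1 <= d)%nat /\ (1 <= n / d)%nat /\ (n = d * (n / d))%nat.
Proof.
  rewrite in_divisors. intros [H1 H2]. apply Nat.Div0.div_exact in H2.
  split; [lia|]. split; [|exact H2]. destruct (n / d)%nat; lia.
Qed.

Lemma fourier_hecke k n f a : fourier f a -> fourier (hecke k n f) (hecke_coef k n a).
Proof.
  intros Hf. unfold hecke, hecke_coef.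
  apply (fourier_scal _ _ (RtoC (INR n) ^ (k - 1))).
  apply (fourier_Csum _ (fun d z => / RtoC (INR d) ^ k * Csum (fun b : nat =>
    f ((RtoC (INR (n / d)) * z + RtoC (INR b)) / RtoC (INR d))) (seq 0 d))
    (fun d l => / RtoC (INR d) ^ k * (RtoC (INR d) * spread (n / d) (fun t => a (d * t)%nat) l))).
  intros d Hd. destruct (divisor_quotient d n Hd) as [H1 [H2 _]].
  apply (fourier_scal _ _ (/ RtoC (INR d) ^ k)). now apply fourier_average.
Qed.

(** Only [d = n] contributes, since [n / d] has to divide 1. Hence the eigenvalue of [T_n] on a
    normalized eigenform is [a n]. *)
Lemma hecke_coef_1 k n a : (1 <= k)%nat -> (1 <= n)%nat -> hecke_coef k n a 1 = a n.
Proof.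
  intros Hk Hn. unfold hecke_coef.
  rewrite (Csum_only _ _ _ n (divisors_NoDup n)).
  - rewrite Nat.div_same by lia. unfold spread. simpl Nat.eqb. cbv iota.
    rewrite Nat.div_1_r, Nat.mul_1_r.
    destruct k as [|k]; [lia|]. simpl Nat.sub. rewrite Nat.sub_0_r. simpl Cpow.
    assert (H := RtoC_INR_neq_0 n Hn). assert (H' := Cpow_nz _ k H). field. split; assumption.
  - apply in_divisors. rewrite Nat.Div0.mod_same. lia.
  - intros d Hd Hne. destruct (divisor_quotient d n Hd) as [H1 [H2 H3]].
    unfold spread. rewrite Nat.mod_small; [simpl; ring|].
    destruct (n / d)%nat as [|[|t]]; lia.
Qed.

Definition is_prime (p : nat) : Prop :=
  (2 <= p)%nat /\ forall d, (1 <= d)%nat -> Nat.divide d p -> d = 1%nat \/ d = p.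

Lemma divisors_prime p : is_prime p -> Permutation (divisors p) (1%nat :: p :: nil).
Proof.
  intros [Hp H]. apply NoDup_Permutation.
  - apply divisors_NoDup.
  - repeat constructor; simpl; lia.
  - intros d. rewrite in_divisors. simpl. split.
    + intros [H1 H2]. apply Nat.Lcm0.mod_divide in H2. destruct (H d ltac:(lia) H2); auto.
    + intros [<-|[<-|[]]].
      * rewrite Nat.mod_1_r. lia.
      * rewrite Nat.Div0.mod_same. lia.
Qed.

(** The divisor [d = p] yields the coefficient at [p * p], and [d = 1] yields the one at 1. For an
    eigenform the left-hand side is [a(p)^2]. *)
Lemma hecke_coef_prime k p a : (1 <= k)%nat -> is_prime p ->
  hecke_coef k p a p = a (p * p)%nat + RtoC (INR p) ^ (k - 1) * a 1%nat.
Proof.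
  intros Hk Hp. unfold hecke_coef. rewrite (Csum_perm _ _ _ _ (divisors_prime p Hp)).
  destruct Hp as [Hp _]. rewrite !Csum_cons, Csum_nil.
  rewrite Nat.div_1_r, Nat.div_same by lia. unfold spread.
  rewrite Nat.Div0.mod_same, Nat.mod_1_r, Nat.div_same, Nat.div_1_r by lia. simpl Nat.eqb. cbv iota.
  destruct k as [|k]; [lia|]. simpl Nat.sub. rewrite Nat.sub_0_r, Nat.mul_1_l. simpl INR.
  rewrite Cpow_1_l. simpl Cpow.
  assert (H := RtoC_INR_neq_0 p ltac:(lia)). assert (H' := Cpow_nz _ k H). field. repeat split; try assumption.
Qed.

(** With [y = Im z], the points [((n/d) z + b) / d] have height [n y / d^2], so [f] is at most
    [M d^k / (n y)^(k/2)] there. Cancelling [d^k] leaves [d <= n] equal bounds for each of at most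
    [n] divisors; with [n^(k-1)] in front this makes [n^(k+1-k/2)]. *)
Lemma hecke_inv_norm_le k n f M : (1 <= k)%nat -> (1 <= n)%nat ->
  (forall z, upper z -> (inv_norm k f z <= M)%R) -> (0 <= M)%R ->
  forall z, upper z -> (inv_norm k (hecke k n f) z <= INR n * sqrt (INR n) ^ k * M)%R.
Proof.
  intros Hk Hn HM HM0 z Hz.
  assert (HnR : (0 < INR n)%R) by (apply lt_0_INR; lia).
  set (y := Im z). assert (Hy : (0 < y)%R) by exact Hz.
  assert (Hs : (0 < sqrt (INR n))%R) by (now apply sqrt_lt_R0).
  assert (Hsk : (0 < sqrt (INR n) ^ k)%R) by (now apply pow_lt).
  assert (Hsy : (0 < sqrt y ^ k)%R) by (apply pow_lt, sqrt_lt_R0, Hy).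
  assert (Hd : forall d, In d (divisors n) ->
    (Cmod (/ RtoC (INR d) ^ k * Csum (fun b : nat =>
      f ((RtoC (INR (n / d)) * z + RtoC (INR b)) / RtoC (INR d))%C) (seq 0 d))%C
      <= INR n * (M / (sqrt (INR n) ^ k * sqrt y ^ k)))%R).
  { intros d Hdn. destruct (divisor_quotient d n Hdn) as [H1 [H2 H3]].
    apply in_divisors in Hdn. destruct Hdn as [[_ Hdn] _].
    assert (HdR : (0 < INR d)%R) by (apply lt_0_INR; lia).
    assert (HeR : (0 < INR (n / d))%R) by (apply lt_0_INR; lia).
    assert (HdC := RtoC_INR_neq_0 d H1).
    assert (Hdk : (0 < INR d ^ k)%R) by (now apply pow_lt).
    set (B := (M * INR d ^ k / (sqrt (INR n) ^ k * sqrt y ^ k))%R).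
    assert (Hb : forall b, In b (seq 0 d) ->
      (Cmod (f ((RtoC (INR (n / d)) * z + RtoC (INR b)) / RtoC (INR d))%C) <= B)%R).
    { intros b _. set (w := (RtoC (INR (n / d)) * z + RtoC (INR b)) / RtoC (INR d)).
      assert (Hw : Im w = (INR (n / d) * y / INR d)%R) by (apply upper_affine; assumption).
      assert (Hwu : upper w).
      { unfold upper. rewrite Hw. apply Rdiv_lt_0_compat; [apply Rmult_lt_0_compat; assumption|exact HdR]. }
      assert (Hsw : sqrt (Im w) = (sqrt (INR n) * sqrt y / INR d)%R).
      { rewrite Hw. rewrite <- sqrt_mult by lra.
        rewrite <- (sqrt_pow2 (INR d)) at 2 by lra. rewrite <- sqrt_div_alt by nra. f_equal.
        rewrite H3 at 2. rewrite mult_INR. field. lra. }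
      assert (H := HM w Hwu). unfold inv_norm in H. rewrite Hsw in H.
      unfold Rdiv in H. rewrite !Rpow_mult_distr, pow_inv in H. unfold B.
      set (S := (sqrt (INR n) ^ k * sqrt y ^ k)%R) in *.
      assert (HS : (0 < S)%R) by (now apply Rmult_lt_0_compat).
      apply Rmult_le_reg_r with (S * / INR d ^ k)%R; [apply Rmult_lt_0_compat; [exact HS|now apply Rinv_0_lt_compat]|].
      replace (M * INR d ^ k / S * (S * / INR d ^ k))%R with M by (field; lra). exact H. }
    rewrite Cmod_mult, Cmod_inv, Cmod_pow, Cmod_INR by (apply Cpow_nz; exact HdC).
    assert (H := Cmod_Csum_le _ _ _ B Hb). rewrite length_seq in H.
    apply Rle_trans with (/ INR d ^ k * (INR d * B))%R.
    - apply Rmult_le_compat_l; [now apply Rlt_le, Rinv_0_lt_compat|exact H].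
    - unfold B. set (S := (sqrt (INR n) ^ k * sqrt y ^ k)%R) in *.
      assert (HS : (0 < S)%R) by (now apply Rmult_lt_0_compat).
      replace (/ INR d ^ k * (INR d * (M * INR d ^ k / S)))%R with (INR d * (M / S))%R by (field; lra).
      apply Rmult_le_compat_r; [apply Rmult_le_pos; [exact HM0|now apply Rlt_le, Rinv_0_lt_compat]|].
      now apply le_INR. }
  assert (H := Cmod_Csum_le _ _ _ _ Hd).
  unfold inv_norm, hecke. fold y. rewrite Cmod_mult, Cmod_pow, Cmod_INR.
  set (T := Cmod (Csum _ _)) in *.
  set (V := (M / (sqrt (INR n) ^ k * sqrt y ^ k))%R) in *.
  assert (HS : (0 < sqrt (INR n) ^ k * sqrt y ^ k)%R) by (now apply Rmult_lt_0_compat).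
  assert (HV : (0 <= V)%R) by (apply Rmult_le_pos; [exact HM0|now apply Rlt_le, Rinv_0_lt_compat]).
  assert (HT : (T <= INR n * (INR n * V))%R).
  { eapply Rle_trans; [exact H|]. apply Rmult_le_compat_r; [apply Rmult_le_pos; lra|].
    apply le_INR, divisors_length. }
  assert (Hn1 : (0 < INR n ^ (k - 1))%R) by (now apply pow_lt).
  apply Rle_trans with (INR n ^ (k - 1) * (INR n * (INR n * V)) * sqrt y ^ k)%R.
  - apply Rmult_le_compat_r; [lra|]. apply Rmult_le_compat_l; lra.
  - right. assert (E : (INR n ^ (k - 1) * INR n = sqrt (INR n) ^ k * sqrt (INR n) ^ k)%R).
    { rewrite <- Rpow_mult_distr, sqrt_sqrt by lra. destruct k as [|k]; [lia|].
      simpl Nat.sub. rewrite Nat.sub_0_r. simpl. ring. }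
    transitivity (INR n ^ (k - 1) * INR n * INR n * V * sqrt y ^ k)%R; [ring|].
    rewrite E. unfold V. field. lra.
Qed.

Definition eigen_coef (k : nat) (a : nat -> C) : Prop :=
  (1 <= k)%nat /\ a 0%nat = 0 /\ a 1%nat = 1 /\
  (forall n l, (1 <= n)%nat -> hecke_coef k n a l = a n * a l) /\
  (forall n, (1 <= n)%nat -> (Cmod (a n) <= INR n * sqrt (INR n) ^ k)%R).

(** Since [T_n] multiplies the bound of the invariant norm by at most [n * n^(k/2)], so does
    its eigenvalue [a(n)]; this substitute for Deligne's bound is uniform in [f]. *)
Lemma cuspidal_eigenform_coef k f : cuspidal_eigenform k f ->
  automorphic k f /\ exists a, fourier f a /\ eigen_coef k a.
Proof.
  intros [[[_ [Hf _]] [a [Ha Ha0]]] [Hh [b [Hb Hb1]]]].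
  assert (Hab := fourier_unique _ _ _ _ Hb Ha (fun _ _ => eq_refl)).
  assert (Ha1 : a 1%nat = 1) by (rewrite <- Hab; exact Hb1).
  split; [exact Hf|]. exists a. split; [exact Ha|].
  assert (Hnz : ~ forall z, upper z -> f z = 0).
  { intros H0. assert (H : a 1%nat = 0 * a 1%nat).
    { apply (fourier_unique f (fun z => 0 * f z) a (fun n => 0 * a n) Ha).
      - now apply fourier_scal.
      - intros z Hz. rewrite H0 by exact Hz. ring. }
    rewrite Ha1, Cmult_0_l in H. now apply C1_nz. }
  (* In weight 0 the vanishing criterion holds already for [N = 1]: it reads [2/5 * 5/3 < 1]. *)
  assert (Hk : (1 <= k)%nat).
  { destruct k as [|k]; [|lia]. exfalso. apply Hnz.
    apply (automorphic_vanish 0 f a 1 Hf Ha (Nat.le_refl 1)).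
    - intros n Hn. replace n with 0%nat by lia. exact Ha0.
    - simpl. lra. }
  assert (Hev : forall n, (1 <= n)%nat -> forall z, upper z -> hecke k n f z = a n * f z).
  { intros n Hn. destruct (Hh n Hn) as [lam Hlam].
    assert (E : a n = lam).
    { rewrite <- (hecke_coef_1 k n a Hk Hn).
      rewrite (fourier_unique _ _ _ _ (fourier_hecke k n f a Ha) (fourier_scal f a lam Ha) Hlam 1).
      rewrite Ha1. ring. }
    intros z Hz. rewrite E. now apply Hlam. }
  repeat split; auto.
  - intros n l Hn. apply (fourier_unique _ _ _ _ (fourier_hecke k n f a Ha) (fourier_scal f a (a n) Ha)).
    exact (Hev n Hn).
  - intros n Hn. destruct (Rle_lt_dec (Cmod (a n)) (INR n * sqrt (INR n) ^ k)) as [H|H]; [exact H|].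
    exfalso. apply Hnz. set (c := (INR n * sqrt (INR n) ^ k)%R) in *.
    assert (Hc : (0 <= c)%R) by (apply Rmult_le_pos; [apply pos_INR|apply pow_le, sqrt_pos]).
    destruct (cusp_inv_norm_bounded k f a Hf Ha Ha0) as [M [HM0 HM]].
    assert (Hl : (0 < Cmod (a n))%R) by lra.
    (* If [|a(n)|] exceeded [c], dividing the bound for [T_n f = a(n) f] by [|a(n)|] would improve
       every bound for the invariant norm of [f] by a fixed factor below 1. *)
    apply (inv_norm_contract k f (c / Cmod (a n)) M); auto.
    + split; [apply Rmult_le_pos; [exact Hc|now apply Rlt_le, Rinv_0_lt_compat]|].
      apply Rmult_lt_reg_r with (Cmod (a n)); [exact Hl|].
      replace (c / Cmod (a n) * Cmod (a n))%R with c by (field; lra). lra.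
    + intros M' HM0' HM' z Hz.
      assert (H1 := hecke_inv_norm_le k n f M' Hk Hn HM' HM0' z Hz).
      unfold inv_norm in *. rewrite Hev, Cmod_mult in H1 by assumption. fold c in H1.
      apply Rmult_le_reg_l with (Cmod (a n)); [exact Hl|].
      replace (Cmod (a n) * (c / Cmod (a n) * M'))%R with (c * M')%R by (field; lra). lra.
Qed.

(** * Finiteness in a fixed weight *)

(** Gaussian elimination, by induction on the number of coordinates: an entry with nonzero last
    coordinate serves as pivot, and the relation among the reduced vectors determines its
    coefficient. Coefficients travel with the entries, so the pivot may change the order. *)
Lemma linear_dependence (T : Type) N : forall (v : T -> nat -> C) (l : list T), (N < length l)%nat ->
  exists L : list (C * T), Permutation (map snd L) l /\ (exists x, In x L /\ fst x <> 0) /\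
    forall n, (n < N)%nat -> Csum (fun x => fst x * v (snd x) n) L = 0.
Proof.
  induction N as [|N IH]; intros v l Hl.
  - exists (map (fun t => (RtoC 1, t)) l). split; [|split].
    + rewrite map_map, map_id. apply Permutation_refl.
    + destruct l as [|t l]; [simpl in Hl; lia|]. exists (RtoC 1, t). simpl. split; [auto|apply C1_nz].
    + intros n Hn. lia.
  - destruct (classic (exists t, In t l /\ v t N <> 0)) as [[t [Ht Hv]]|Hno].
    + destruct (in_split t l Ht) as [l1 [l2 ->]].
      set (w := fun s n => v s n - v s N / v t N * v t n).
      destruct (IH w (l1 ++ l2)) as [L [HP [[x [Hx Hx0]] HL]]].
      { rewrite length_app in *. simpl in Hl. lia. }
      exists ((- Csum (fun x => fst x * (v (snd x) N / v t N)) L, t) :: L). split; [|split].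
      * simpl. apply Permutation_cons_app. exact HP.
      * exists x. simpl. auto.
      * intros n Hn. rewrite Csum_cons. cbn [fst snd].
        transitivity (Csum (fun x => fst x * w (snd x) n) L).
        -- rewrite (Csum_ext _ (fun x => fst x * w (snd x) n)
             (fun x => fst x * v (snd x) n + - v t n * (fst x * (v (snd x) N / v t N)))).
           ++ rewrite Csum_plus, Csum_scal. ring.
           ++ intros y _. unfold w. ring.
        -- destruct (Nat.eq_dec n N) as [->|Hne]; [|apply HL; lia].
           apply Csum_0. intros y _. unfold w. field. exact Hv.
    + destruct l as [|t l]; [simpl in Hl; lia|].
      destruct (IH v l) as [L [HP [[x [Hx Hx0]] HL]]]; [simpl in Hl; lia|].
      exists ((RtoC 0, t) :: L). split; [|split].
      * simpl. now apply perm_skip.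
      * exists x. simpl. auto.
      * intros n Hn. rewrite Csum_cons. cbn [fst snd]. rewrite Cmult_0_l, Cplus_0_l.
        destruct (Nat.eq_dec n N) as [->|Hne]; [|apply HL; lia].
        apply Csum_0. intros y Hy. replace (v (snd y) N) with (RtoC 0); [ring|].
        symmetry. apply NNPP. intros Hc. apply Hno. exists (snd y). split; [|exact Hc].
        right. apply (Permutation_in _ HP). now apply in_map.
Qed.

Lemma hecke_coef_lin k n (c : C) (a b : nat -> C) l :
  hecke_coef k n (fun m => c * a m + b m) l = c * hecke_coef k n a l + hecke_coef k n b l.
Proof.
  unfold hecke_coef.
  rewrite (Csum_ext _ _ (fun d =>
    c * (/ RtoC (INR d) ^ k * (RtoC (INR d) * spread (n / d) (fun t => a (d * t)%nat) l))
    + / RtoC (INR d) ^ k * (RtoC (INR d) * spread (n / d) (fun t => b (d * t)%nat) l))).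
  - rewrite Csum_plus, Csum_scal. ring.
  - intros d _. unfold spread. destruct (Nat.eqb _ _); ring.
Qed.

Lemma hecke_coef_0 k n (a : nat -> C) l : (forall m, a m = 0) -> hecke_coef k n a l = 0.
Proof.
  intros H. unfold hecke_coef. rewrite Csum_0; [ring|].
  intros d _. unfold spread. destruct (Nat.eqb _ _); [rewrite H|]; ring.
Qed.

Lemma hecke_coef_Csum (T : Type) k n (a : T -> nat -> C) (L : list (C * T)) l :
  hecke_coef k n (fun m => Csum (fun x => fst x * a (snd x) m) L) l
  = Csum (fun x => fst x * hecke_coef k n (a (snd x)) l) L.
Proof.
  induction L as [|x L IH].
  - rewrite Csum_nil. apply hecke_coef_0. intros m. reflexivity.
  - rewrite Csum_cons, <- IH, <- hecke_coef_lin. unfold hecke_coef.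
    reflexivity.
Qed.

(** The argument for the independence of distinct characters. Applying [T_n] to the relation and
    subtracting [a t n] times it removes the head [t] and multiplies the coefficient of each [s] by
    [a s n - a t n]. The index [n] is chosen anew for each entry, to make that entry's factor
    nonzero. The head is settled last, by the coefficient at 1. *)
Lemma eigen_coef_independent (T : Type) k (a : T -> nat -> C) (L : list (C * T)) :
  (forall x, In x L -> eigen_coef k (a (snd x))) ->
  (forall s t, In s (map snd L) -> In t (map snd L) -> s <> t -> exists n, (1 <= n)%nat /\ a s n <> a t n) ->
  NoDup (map snd L) ->
  (forall l, Csum (fun x => fst x * a (snd x) l) L = 0) ->
  forall x, In x L -> fst x = 0.
Proof.
  remember (length L) as N eqn:HN. revert L HN.
  induction N as [|N IH]; intros L HN He Hs Hd H0 x Hx.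
  { destruct L; [contradiction|discriminate]. }
  destruct L as [|[c t] L]; [contradiction|].
  simpl in HN. injection HN as HN. simpl in Hd. inversion Hd as [|? ? Hnt HdL]; subst.
  assert (HL : forall y, In y L -> fst y = 0).
  { intros y Hy. destruct (Hs (snd y) t) as [n [Hn Hne]].
    - simpl. right. now apply in_map.
    - simpl. auto.
    - intros E. apply Hnt. rewrite <- E. now apply in_map.
    - set (L' := map (fun x => (fst x * (a (snd x) n - a t n), snd x)) L).
      assert (Hm : map snd L' = map snd L) by (unfold L'; now rewrite map_map).
      assert (H : fst (fst y * (a (snd y) n - a t n), snd y) = 0).
      { apply (IH L').
        - unfold L'. now rewrite length_map.
        - intros z Hz. unfold L' in Hz. apply in_map_iff in Hz. destruct Hz as [z' [<- Hz']].
          apply (He z'). simpl. auto.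
        - rewrite Hm. intros s s' H1 H2. apply Hs; simpl; auto.
        - now rewrite Hm.
        - intros l. unfold L'. rewrite Csum_map. cbn [fst snd].
          assert (E1 : Csum (fun x => fst x * (a (snd x) n * a (snd x) l)) ((c, t) :: L) = 0).
          { rewrite <- (hecke_coef_0 k n _ l H0), hecke_coef_Csum. apply Csum_ext.
            intros z Hz. destruct (He z Hz) as [_ [_ [_ [Hz1 _]]]]. now rewrite Hz1. }
          assert (E2 := H0 l). rewrite Csum_cons in E1, E2. cbn [fst snd] in E1, E2.
          rewrite (Csum_ext _ _ (fun x => fst x * (a (snd x) n * a (snd x) l) + - a t n * (fst x * a (snd x) l)))
            by (intros; ring).
          rewrite Csum_plus, Csum_scal.
          replace (Csum (fun x => fst x * (a (snd x) n * a (snd x) l)) L) with (- (c * (a t n * a t l))).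
          + replace (Csum (fun x => fst x * a (snd x) l) L) with (- (c * a t l)); [ring|].
            symmetry. apply Ceq_minus. rewrite <- E2. ring.
          + symmetry. apply Ceq_minus. rewrite <- E1. ring.
        - unfold L'. apply in_map_iff. exists y. auto. }
      simpl in H. apply NNPP. intros Hy0.
      apply (Cmult_neq_0 _ _ Hy0 (Cminus_eq_contra _ _ Hne)). exact H. }
  destruct Hx as [<-|Hx]; [|now apply HL].
  simpl. destruct (He (c, t) (or_introl eq_refl)) as [_ [_ [H1 _]]]. simpl in H1.
  assert (E := H0 1%nat). rewrite Csum_cons in E. cbn [fst snd] in E. rewrite H1 in E.
  rewrite Csum_0 in E.
  - rewrite <- E. ring.
  - intros y Hy. rewrite (HL y Hy). ring.
Qed.

Lemma finitely_many_subset (Q Q' : (C -> C) -> Prop) :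
  (forall h, Q h -> Q' h) -> finitely_many Q' -> finitely_many Q.
Proof. intros H [L HL]. exists L. auto. Qed.

Lemma finitely_many_union (Q Q' : (C -> C) -> Prop) :
  finitely_many Q -> finitely_many Q' -> finitely_many (fun h => Q h \/ Q' h).
Proof.
  intros [L HL] [L' HL']. exists (L ++ L'). intros h [H|H].
  - destruct (HL h H) as [g [Hg E]]. exists g. split; [apply in_or_app; auto|exact E].
  - destruct (HL' h H) as [g [Hg E]]. exists g. split; [apply in_or_app; auto|exact E].
Qed.

(** Greedy choice: a list of forms that could not be prolonged would itself witness finiteness. *)
Lemma many_cuspidal_eigenforms k : ~ finitely_many (cuspidal_eigenform k) ->
  forall N, exists l : list ((C -> C) * (nat -> C)), length l = N /\ NoDup l /\
    (forall t, In t l -> automorphic k (fst t) /\ fourier (fst t) (snd t) /\ eigen_coef k (snd t)) /\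
    (forall s t, In s l -> In t l -> s <> t -> ~ forall z, upper z -> fst s z = fst t z).
Proof.
  intros Hinf. induction N as [|N [l [Hlen [Hnd [Hl Hdist]]]]].
  - exists nil. repeat split; simpl; try contradiction. constructor.
  - assert (Hnew : exists h, cuspidal_eigenform k h /\
      forall t, In t l -> ~ forall z, upper z -> h z = fst t z).
    { apply NNPP. intros Hn. apply Hinf. exists (map fst l). intros h Hh.
      apply NNPP. intros Hg. apply Hn. exists h. split; [exact Hh|].
      intros t Ht E. apply Hg. exists (fst t). split; [now apply in_map|exact E]. }
    destruct Hnew as [h [Hh Hhl]].
    destruct (cuspidal_eigenform_coef k h Hh) as [Hauto [a [Ha1 Ha2]]].
    exists ((h, a) :: l). split; [simpl; congruence|]. split; [|split].
    + constructor; [|exact Hnd]. intros Hin. apply (Hhl (h, a) Hin). reflexivity.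
    + intros t [<-|Ht]; [simpl; auto|now apply Hl].
    + intros s t [<-|Hs] [<-|Ht] Hne.
      * congruence.
      * now apply Hhl.
      * intros E. apply (Hhl s Hs). intros z Hz. symmetry. now apply E.
      * now apply Hdist.
Qed.

Lemma automorphic_Csum (T : Type) k (f : T -> C -> C) (c : T -> C) l :
  (forall x, In x l -> automorphic k (f x)) ->
  automorphic k (fun z => Csum (fun x => c x * f x z) l).
Proof.
  intros H a b c' d z Hdet Hz. rewrite <- Csum_scal. apply Csum_ext. intros x Hx.
  rewrite (H x Hx a b c' d z Hdet Hz). ring.
Qed.

(** The vanishing criterion holds for some [N] depending on [k]. Among [N + 1] distinct eigenforms
    some nontrivial combination has its first [N] coefficients zero; it vanishes, against
    independence. *)
Lemma cuspidal_eigenforms_finite k : finitely_many (cuspidal_eigenform k).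
Proof.
  apply NNPP. intros Hinf.
  assert (HN : exists N, (1 <= N)%nat /\ (sqrt 2 ^ k * ((2 / 5) ^ N * (5 / 3)) < 1)%R).
  { assert (Hs : (0 < sqrt 2 ^ k)%R) by (apply pow_lt, sqrt_lt_R0; lra).
    destruct (pow_lt_1_zero (2 / 5) ltac:(rewrite Rabs_pos_eq; lra) (/ (sqrt 2 ^ k * (5 / 3)))
      ltac:(apply Rinv_0_lt_compat; nra)) as [N HN].
    exists (S N). split; [lia|]. specialize (HN (S N) ltac:(lia)). rewrite Rabs_pos_eq in HN by (apply pow_le; lra).
    apply (Rmult_lt_compat_r (sqrt 2 ^ k * (5 / 3))) in HN; [|nra].
    rewrite Rinv_l in HN by nra. nra. }
  destruct HN as [N [HN1 HN]].
  destruct (many_cuspidal_eigenforms k Hinf (S N)) as [l [Hlen [Hnd [Hl Hdist]]]].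
  destruct (linear_dependence _ N (fun t => snd t) l ltac:(lia)) as [L [HP [[x [Hx Hx0]] HL]]].
  assert (HLl : forall y, In y L -> In (snd y) l).
  { intros y Hy. apply (Permutation_in _ HP). now apply in_map. }
  set (F := fun z => Csum (fun y => fst y * fst (snd y) z) L).
  set (A := fun n => Csum (fun y => fst y * snd (snd y) n) L).
  assert (HF : fourier F A).
  { apply (fourier_Csum _ (fun y z => fst y * fst (snd y) z) (fun y n => fst y * snd (snd y) n)).
    intros y Hy. apply fourier_scal. now apply Hl, HLl. }
  assert (HF0 : forall z, upper z -> F z = 0).
  { apply (automorphic_vanish k F A N); auto.
    apply (automorphic_Csum _ k (fun y => fst (snd y)) fst). intros y Hy. now apply Hl, HLl. }
  apply Hx0. apply (eigen_coef_independent _ k snd L).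
  - intros y Hy. now apply Hl, HLl.
  - intros s t Hs Ht Hne. apply (Permutation_in _ HP) in Hs, Ht.
    apply NNPP. intros Hn. apply (Hdist s t Hs Ht Hne). intros z Hz.
    destruct (Hl s Hs) as [_ [Hs1 Hs2]]. destruct (Hl t Ht) as [_ [Ht1 Ht2]].
    apply (cseries_unique _ _ _ (Hs1 z Hz)).
    refine (cseries_ext _ _ _ _ (Ht1 z Hz)). intros n. f_equal.
    destruct n as [|n].
    + destruct Hs2 as [_ [-> _]]. now destruct Ht2 as [_ [-> _]].
    + apply NNPP. intros E. apply Hn. exists (S n). split; [lia|]. intros E'. apply E. now rewrite E'.
  - apply (Permutation_NoDup (Permutation_sym HP) Hnd).
  - intros n. assert (H := fourier_unique F (fun z => 0 * F z) A (fun n => 0 * A n) HF (fourier_scal _ _ _ HF)).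
    change (A n = 0). rewrite H; [ring|]. intros z Hz. rewrite HF0 by exact Hz. ring.
  - exact Hx.
Qed.

Lemma eisenstein_finite k : finitely_many (eisenstein k).
Proof.
  destruct (classic (exists g, eisenstein k g)) as [[g Hg]|Hn].
  - exists (g :: nil). intros h Hh. exists g. split; [simpl; auto|]. intros z Hz.
    destruct Hg as [_ [_ Hg]], Hh as [_ [_ Hh]]. exact (cseries_unique _ _ _ (Hh z Hz) (Hg z Hz)).
  - exists nil. intros h Hh. exfalso. eauto.
Qed.

Lemma eigenforms_finite K : finitely_many (fun h => exists k, (k < K)%nat /\ eigenform k h).
Proof.
  induction K as [|K IH].
  - exists nil. intros h [k [Hk _]]. lia.
  - refine (finitely_many_subset _ _ _ (finitely_many_union _ _ IH
      (finitely_many_union _ _ (eisenstein_finite K) (cuspidal_eigenforms_finite K)))).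
    intros h [k [Hk Hh]]. destruct (Nat.eq_dec k K) as [->|Hne].
    + right. exact Hh.
    + left. exists k. split; [lia|exact Hh].
Qed.

(** * Size of the Eisenstein coefficients *)

Lemma is_series_telescope : is_series (fun n => 2 / (INR (S n) * INR (S (S n))))%R 2%R.
Proof.
  assert (E : forall n, sum_n (fun n => 2 / (INR (S n) * INR (S (S n))))%R n = (2 - 2 * / INR (S (S n)))%R).
  { induction n as [|n IH].
    - rewrite sum_O. simpl. field.
    - rewrite sum_Sn, IH.
      change (2 - 2 * / INR (S (S n)) + 2 / (INR (S (S n)) * INR (S (S (S n)))) = 2 - 2 * / INR (S (S (S n))))%R.
      rewrite (S_INR (S (S n))). assert (0 < INR (S (S n)))%R by (apply lt_0_INR; lia). field. lra. }
  apply (is_lim_seq_ext (fun n => 2 - 2 * / INR (S (S n)))%R _ 2%R); [intros n; now rewrite E|].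
  replace (Finite 2) with (Finite (2 - 2 * 0))%R by (f_equal; ring).
  apply is_lim_seq_minus'; [apply is_lim_seq_const|].
  apply is_lim_seq_mult'; [apply is_lim_seq_const|].
  apply (is_lim_seq_inv (fun n => INR (S (S n))) p_infty); [|discriminate].
  refine (is_lim_seq_ext _ _ _ _ (proj1 (is_lim_seq_incr_n INR 2 p_infty) is_lim_seq_INR)).
  intros n. f_equal. lia.
Qed.

Lemma zeta_term_le k n : (2 <= k)%nat ->
  (0 < / INR (S n) ^ k <= 2 / (INR (S n) * INR (S (S n))))%R.
Proof.
  intros Hk. assert (H1 : (1 <= INR (S n))%R) by (apply (le_INR 1); lia).
  assert (Hp : (0 < INR (S n) ^ k)%R) by (apply pow_lt; lra).
  split; [now apply Rinv_0_lt_compat|].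
  assert (Hk2 : (INR (S n) ^ 2 <= INR (S n) ^ k)%R) by (apply Rle_pow; assumption).
  rewrite (S_INR (S n)). set (x := INR (S n)) in *.
  apply Rle_trans with (/ x ^ 2)%R; [apply Rinv_le_contravar; [apply pow_lt; lra|exact Hk2]|].
  apply Rmult_le_reg_r with (x ^ 2 * (x + 1))%R; [apply Rmult_lt_0_compat; [apply pow_lt|]; lra|].
  replace (/ x ^ 2 * (x ^ 2 * (x + 1)))%R with (x + 1)%R by (field; lra).
  replace (2 / (x * (x + 1)) * (x ^ 2 * (x + 1)))%R with (2 * x)%R by (field; lra). lra.
Qed.

(** The first term gives the lower bound, and comparison with a telescoping series of sum 2 the
    upper one. Being uniform in [k], the bounds determine [|C_k|] up to a factor 2. *)
Lemma zeta_bounds k : (2 <= k)%nat -> (1 <= zeta k <= 2)%R.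
Proof.
  intros Hk.
  assert (Hex : ex_series (fun n => / INR (S n) ^ k)%R).
  { apply (ex_series_le (K := R_AbsRing) (V := R_CompleteNormedModule) _ (fun n => 2 / (INR (S n) * INR (S (S n))))%R).
    - intros n. destruct (zeta_term_le k n Hk) as [H1 H2].
      change (Rabs (/ INR (S n) ^ k) <= 2 / (INR (S n) * INR (S (S n))))%R.
      rewrite Rabs_pos_eq by lra. exact H2.
    - eexists. apply is_series_telescope. }
  assert (Hz := Series_correct _ Hex). fold (zeta k) in Hz. split.
  - refine (is_series_le _ _ _ _ _ (proj1 (proj1 (cseries_iff _ _) (cseries_single 0 (RtoC 1)))) Hz).
    intros [|n]; simpl.
    + rewrite pow1. lra.
    + destruct (zeta_term_le k (S n) Hk) as [H1 _]. simpl in H1. lra.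
  - refine (is_series_le _ _ _ _ _ Hz is_series_telescope).
    intros n. now apply zeta_term_le.
Qed.

(** This is [|C_k| zeta(k)]; without the zeta factor, consecutive values have the exact ratio
    [2 pi / k]. *)
Definition eis_size (k : nat) : R := ((2 * PI) ^ k / INR (fact (k - 1)))%R.

Lemma eis_size_pos k : (0 < eis_size k)%R.
Proof.
  assert (HP := PI_RGT_0). apply Rdiv_lt_0_compat; [apply pow_lt; lra|apply INR_fact_lt_0].
Qed.

Lemma Cmod_eisenstein_const k : (2 <= k)%nat ->
  Cmod (eisenstein_const k) = (eis_size k / zeta k)%R.
Proof.
  intros Hk. assert (HP := PI_RGT_0). assert (Hz := zeta_bounds k Hk). assert (HF := INR_fact_lt_0 (k - 1)).
  unfold eisenstein_const, eis_size. rewrite Cmod_div.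
  - rewrite Cmod_pow, !Cmod_mult, Cmod_Ci, !Cmod_R, !Rabs_pos_eq by nra. rewrite Rmult_1_r. field. lra.
  - intros E. injection E as E. nra.
Qed.

Lemma eisenstein_const_bounds k : (2 <= k)%nat ->
  (eis_size k / 2 <= Cmod (eisenstein_const k) <= eis_size k)%R.
Proof.
  intros Hk. rewrite Cmod_eisenstein_const by exact Hk.
  assert (Hz := zeta_bounds k Hk). assert (HE := eis_size_pos k). unfold Rdiv. split.
  - apply Rmult_le_compat_l; [lra|]. apply Rinv_le_contravar; lra.
  - rewrite <- (Rmult_1_r (eis_size k)) at 2. apply Rmult_le_compat_l; [lra|].
    rewrite <- Rinv_1. apply Rinv_le_contravar; lra.
Qed.

Lemma divisor_sigma_le s n : (INR (divisor_sigma s n) <= INR n ^ S s)%R.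
Proof.
  assert (H : forall l, (forall d, In d l -> (d <= n)%nat) ->
    (list_sum (map (fun d => Nat.pow d s) l) <= length l * Nat.pow n s)%nat).
  { induction l as [|d l IH]; intros Hl; [simpl; lia|].
    change (Nat.pow d s + list_sum (map (fun d => Nat.pow d s) l) <= Nat.pow n s + length l * Nat.pow n s)%nat.
    apply Nat.add_le_mono; [apply Nat.pow_le_mono_l; apply Hl; simpl; auto|].
    apply IH. intros e He. apply Hl. simpl; auto. }
  rewrite <- pow_INR. apply le_INR. unfold divisor_sigma.
  eapply Nat.le_trans; [apply H|].
  - intros d Hd. apply in_divisors in Hd. lia.
  - simpl. apply Nat.mul_le_mono_r, divisors_length.
Qed.

(** The divisor sum is at most [n^k], and with [x = 2 pi n] the product of [eis_size k] and [n^k] is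
    [x * x^(k-1) / (k-1)! <= x exp(x)]: the factorial compensates for the growth in the weight. *)
Lemma eisenstein_coef_le n : exists D, (1 <= D)%R /\
  forall k, (2 <= k)%nat -> (Cmod (eisenstein_coef k n) <= D)%R.
Proof.
  set (x := (2 * PI * INR n)%R).
  assert (Hx : (0 <= x)%R) by (assert (HP := PI_RGT_0); assert (HN := pos_INR n); unfold x; nra).
  assert (Hx1 : (0 <= x * exp x)%R) by (apply Rmult_le_pos; [exact Hx|apply Rlt_le, exp_pos]).
  exists (1 + x * exp x)%R. split; [lra|]. intros k Hk. destruct n as [|n].
  - simpl eisenstein_coef. rewrite Cmod_1. lra.
  - unfold eisenstein_coef. rewrite Cmod_mult, Cmod_INR.
    destruct (eisenstein_const_bounds k Hk) as [_ H1].
    assert (H2 := divisor_sigma_le (k - 1) (S n)). replace (S (k - 1)) with k in H2 by lia.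
    apply Rle_trans with (eis_size k * INR (S n) ^ k)%R.
    + apply Rmult_le_compat; auto using Cmod_ge_0, pos_INR.
    + unfold eis_size. assert (HF := INR_fact_lt_0 (k - 1)).
      replace ((2 * PI) ^ k / INR (fact (k - 1)) * INR (S n) ^ k)%R with (x * (x ^ (k - 1) / INR (fact (k - 1))))%R.
      * assert (H3 := pow_div_fact_le_exp x (k - 1) Hx).
        apply (Rmult_le_compat_l x) in H3; [|exact Hx]. lra.
      * transitivity (x ^ (S (k - 1)) / INR (fact (k - 1)))%R; [simpl; field; lra|].
        replace (S (k - 1)) with k by lia. unfold x. rewrite !Rpow_mult_distr. field. lra.
Qed.

Lemma eis_size_S k : (1 <= k)%nat -> eis_size (S k) = (2 * PI / INR k * eis_size k)%R.
Proof.
  intros Hk. destruct k as [|k]; [lia|]. unfold eis_size. simpl Nat.sub. rewrite Nat.sub_0_r.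
  rewrite fact_simpl, mult_INR. assert (HF := INR_fact_lt_0 k).
  assert (0 < INR (S k))%R by (apply lt_0_INR; lia). simpl pow. field. lra.
Qed.

Lemma eis_size_ratio delta : (0 < delta)%R -> exists N, (1 <= N)%nat /\
  forall a b, (N <= a)%nat -> (a < b)%nat -> (eis_size b <= delta * eis_size a)%R.
Proof.
  intros Hd. assert (HP := PI_RGT_0).
  (* Capping the ratio at 1 keeps the bound in force over all later steps. *)
  set (d := Rmin delta 1). assert (Hd0 : (0 < d)%R) by (apply Rmin_glb_lt; lra).
  assert (Hd1 : (d <= delta)%R) by apply Rmin_l. assert (Hd2 : (d <= 1)%R) by apply Rmin_r.
  destruct (INR_unbounded (2 * PI / d)) as [N HN].
  assert (HN0 : (0 < 2 * PI / d)%R) by (apply Rdiv_lt_0_compat; lra).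
  exists (S N). split; [lia|]. intros a b Ha Hab.
  assert (Hstep : forall k, (S N <= k)%nat -> (eis_size (S k) <= d * eis_size k)%R).
  { intros k Hk. rewrite eis_size_S by lia. apply Rmult_le_compat_r; [apply Rlt_le, eis_size_pos|].
    assert (HkN : (INR N <= INR k)%R) by (apply le_INR; lia).
    apply Rmult_le_reg_r with (INR k / d)%R; [apply Rdiv_lt_0_compat; lra|].
    replace (2 * PI / INR k * (INR k / d))%R with (2 * PI / d)%R by (field; lra).
    replace (d * (INR k / d))%R with (INR k) by (field; lra). lra. }
  apply Rle_trans with (d * eis_size a)%R; [|apply Rmult_le_compat_r; [apply Rlt_le, eis_size_pos|exact Hd1]].
  induction Hab as [|b Hab IH]; [now apply Hstep|].
  assert (H := Hstep b ltac:(lia)). assert (H' := eis_size_pos b). nra.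
Qed.

Lemma eisenstein_const_ratio eps : (0 < eps)%R -> exists N, (2 <= N)%nat /\
  forall a b, (N <= a)%nat -> (a < b)%nat ->
    (Cmod (eisenstein_const b) <= eps * Cmod (eisenstein_const a))%R.
Proof.
  (* Half of [eps] pays for the factor 2 by which [eis_size a] may exceed [|C_a|]. *)
  intros He. destruct (eis_size_ratio (eps / 2) ltac:(lra)) as [N [HN1 HN]].
  exists (S N). split; [lia|]. intros a b Ha Hab.
  assert (H := HN a b ltac:(lia) Hab).
  assert (Hb := eisenstein_const_bounds b ltac:(lia)). assert (Ha' := eisenstein_const_bounds a ltac:(lia)).
  nra.
Qed.

Lemma eisenstein_const_neq_0 k : (2 <= k)%nat -> eisenstein_const k <> 0.
Proof.
  intros Hk. apply Cmod_gt_0. assert (H := eisenstein_const_bounds k Hk).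
  assert (H' := eis_size_pos k). lra.
Qed.

Lemma eisenstein_const_small eps : (0 < eps)%R -> exists N, (2 <= N)%nat /\
  forall k, (N <= k)%nat -> (Cmod (eisenstein_const k) <= eps)%R.
Proof.
  intros He. set (e0 := eis_size 2). assert (He0 : (0 < e0)%R) by apply eis_size_pos.
  (* Ratio 1 bounds all later sizes by [c], the size at [N1]; one further step with ratio [eps / c]
     brings them below [eps]. *)
  destruct (eis_size_ratio 1 ltac:(lra)) as [N1 [HN1 H1]].
  set (c := eis_size N1). assert (Hc : (0 < c)%R) by apply eis_size_pos.
  destruct (eis_size_ratio (eps / c) ltac:(now apply Rdiv_lt_0_compat)) as [N2 [HN2 H2]].
  exists (S (S (N1 + N2))). split; [lia|]. intros k Hk.
  destruct (eisenstein_const_bounds k ltac:(lia)) as [_ H3].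
  assert (H4 := H2 (S (N1 + N2)) k ltac:(lia) ltac:(lia)).
  assert (H5 := H1 N1 (S (N1 + N2)) ltac:(lia) ltac:(lia)). fold c in H5.
  assert (H6 : (eps / c * eis_size (S (N1 + N2)) <= eps / c * c)%R).
  { apply Rmult_le_compat_l; [apply Rlt_le; now apply Rdiv_lt_0_compat|lra]. }
  replace (eps / c * c)%R with eps in H6 by (field; lra). lra.
Qed.

(** * Coefficients of products of eigenforms *)

Definition conv_list (l : list (nat * (nat -> C))) : nat -> C :=
  fold_right (fun x b => conv (snd x) b) conv_unit l.

Lemma conv_list_cons k a l n : conv_list ((k, a) :: l) n = conv a (conv_list l) n.
Proof. reflexivity. Qed.

(** [Rel] is what is remembered of each factor; it will be [eis_coef] for Eisenstein series and
    [eigen_coef] for cuspidal eigenforms. *)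
Lemma product_of_coef (Phi : nat -> (C -> C) -> Prop) (Rel : nat -> (nat -> C) -> Prop) n w P :
  (forall k f, Phi k f -> exists a, fourier f a /\ Rel k a) ->
  product_of Phi n w P ->
  exists l, length l = n /\ (forall x, In x l -> Rel (fst x) (snd x)) /\
    list_sum (map fst l) = w /\ fourier P (conv_list l).
Proof.
  intros HR [l [<- [Hl [<- HP]]]].
  assert (H : exists l', length l' = length l /\ (forall x, In x l' -> Rel (fst x) (snd x)) /\
    list_sum (map fst l') = list_sum (map fst l) /\
    fourier (fun z => Cprod (fun kf => snd kf z) l) (conv_list l')).
  { clear HP. induction l as [|[k f] l IH].
    - exists nil. repeat split; simpl; try contradiction. exact fourier_one.
    - destruct IH as [l' [H1 [H2 [H3 H4]]]]; [intros; apply Hl; simpl; auto|].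
      destruct (HR k f (Hl (k, f) (or_introl eq_refl))) as [a [Ha HRa]].
      exists ((k, a) :: l'). split; [simpl; congruence|]. split; [|split].
      + intros x [<-|Hx]; auto.
      + change (k + list_sum (map fst l') = k + list_sum (map fst l))%nat. now rewrite H3.
      + exact (fourier_mult _ _ _ _ Ha H4). }
  destruct H as [l' [H1 [H2 [H3 H4]]]]. exists l'. repeat split; auto.
  apply (fourier_ext _ _ _ (fun z Hz => eq_sym (HP z Hz)) H4).
Qed.

Definition eis_coef (k : nat) (a : nat -> C) : Prop := (4 <= k)%nat /\ a = eisenstein_coef k.

Lemma conv_unit_r a n : conv a conv_unit n = a n.
Proof.
  unfold conv. rewrite (Csum_only _ _ _ n).
  - unfold conv_unit. rewrite Nat.sub_diag. simpl. ring.
  - apply seq_NoDup.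
  - apply in_seq. lia.
  - intros j Hj Hne. apply in_seq in Hj. unfold conv_unit.
    destruct (Nat.eqb_spec (n - j) 0); [lia|ring].
Qed.

Lemma conv_0 a b : conv a b 0 = a 0%nat * b 0%nat.
Proof. unfold conv. simpl seq. rewrite Csum_cons, Csum_nil. simpl Nat.sub. ring. Qed.

Lemma conv_1 a b : conv a b 1 = a 0%nat * b 1%nat + a 1%nat * b 0%nat.
Proof. unfold conv. simpl seq. rewrite !Csum_cons, Csum_nil. simpl Nat.sub. ring. Qed.

Lemma conv_Cmod_le a b n X Y : (0 <= X)%R -> (0 <= Y)%R ->
  (forall j, (j <= n)%nat -> (Cmod (a j) <= X)%R) ->
  (forall j, (j <= n)%nat -> (Cmod (b j) <= Y)%R) ->
  (Cmod (conv a b n) <= INR (S n) * (X * Y))%R.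
Proof.
  intros HX HY Ha Hb. unfold conv. rewrite <- (length_seq (S n) 0) at 2. apply Cmod_Csum_le.
  intros j Hj. apply in_seq in Hj. rewrite Cmod_mult.
  apply Rmult_le_compat; try apply Cmod_ge_0; [apply Ha|apply Hb]; lia.
Qed.

Lemma eis_list_0 l : (forall x, In x l -> eis_coef (fst x) (snd x)) -> conv_list l 0%nat = 1.
Proof.
  induction l as [|[k a] l IH]; intros H; [reflexivity|].
  rewrite conv_list_cons, conv_0, IH by (intros; apply H; simpl; auto).
  destruct (H (k, a) (or_introl eq_refl)) as [_ E]. simpl in E. rewrite E. simpl. ring.
Qed.

Lemma eis_list_1 l : (forall x, In x l -> eis_coef (fst x) (snd x)) ->
  conv_list l 1%nat = Csum (fun x => eisenstein_const (fst x)) l.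
Proof.
  induction l as [|[k a] l IH]; intros H; [reflexivity|].
  assert (Hl : forall x, In x l -> eis_coef (fst x) (snd x)) by (intros; apply H; simpl; auto).
  rewrite conv_list_cons, conv_1, IH, eis_list_0, Csum_cons by exact Hl.
  destruct (H (k, a) (or_introl eq_refl)) as [_ E]. simpl in E. rewrite E.
  unfold eisenstein_coef. replace (divisor_sigma (k - 1) 1) with 1%nat.
  - simpl. ring.
  - unfold divisor_sigma, divisors. simpl. now rewrite Nat.pow_1_l.
Qed.

Lemma eis_list_weight l : (forall x, In x l -> eis_coef (fst x) (snd x)) ->
  (4 * length l <= list_sum (map fst l))%nat.
Proof.
  induction l as [|[k a] l IH]; intros H; [simpl; lia|].
  destruct (H (k, a) (or_introl eq_refl)) as [E _]. cbn [fst] in E.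
  specialize (IH ltac:(intros; apply H; simpl; auto)).
  change (4 * S (length l) <= k + list_sum (map fst l))%nat. lia.
Qed.

Lemma eisenstein_coef_le_upto N : exists D, (1 <= D)%R /\
  forall k j, (2 <= k)%nat -> (j <= N)%nat -> (Cmod (eisenstein_coef k j) <= D)%R.
Proof.
  induction N as [|N [D [HD IH]]].
  - destruct (eisenstein_coef_le 0) as [D [HD H]]. exists D. split; [exact HD|].
    intros k j Hk Hj. replace j with 0%nat by lia. now apply H.
  - destruct (eisenstein_coef_le (S N)) as [D' [HD' H]]. exists (Rmax D D').
    split; [eapply Rle_trans; [exact HD|apply Rmax_l]|].
    intros k j Hk Hj. destruct (Nat.eq_dec j (S N)) as [->|Hne].
    + eapply Rle_trans; [now apply H|apply Rmax_r].
    + eapply Rle_trans; [apply IH; [exact Hk|lia]|apply Rmax_l].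
Qed.

(** [D] depends on the number of factors and on the range of indices, never on the weights. *)
Lemma eis_list_le N n : exists D, (1 <= D)%R /\
  forall l, length l = n -> (forall x, In x l -> eis_coef (fst x) (snd x)) ->
  forall j, (j <= N)%nat -> (Cmod (conv_list l j) <= D)%R.
Proof.
  destruct (eisenstein_coef_le_upto N) as [D0 [HD0 H0]].
  assert (HN : (1 <= INR (S N))%R) by (apply (le_INR 1); lia).
  induction n as [|n [D [HD IH]]].
  - exists 1%R. split; [lra|]. intros l Hl _ j _. destruct l; [|discriminate].
    simpl. unfold conv_unit. destruct (Nat.eqb j 0); [rewrite Cmod_1|rewrite Cmod_0]; lra.
  - exists (INR (S N) * (D0 * D))%R. split; [assert (1 <= D0 * D)%R by nra; nra|].
    intros [|[k a] l] Hl H j Hj; [discriminate|]. rewrite conv_list_cons.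
    destruct (H (k, a) (or_introl eq_refl)) as [Hk E]. cbn [fst snd] in *.
    eapply Rle_trans.
    + apply (conv_Cmod_le _ _ j D0 D); try lra.
      * intros i Hi. rewrite E. apply H0; lia.
      * intros i Hi. apply IH; [simpl in Hl; lia| |lia]. intros; apply H; simpl; auto.
    + apply Rmult_le_compat_r; [nra|]. apply le_INR. lia.
Qed.

Lemma cusp_list_0 l : l <> nil -> (forall x, In x l -> eigen_coef (fst x) (snd x)) ->
  conv_list l 0%nat = 0.
Proof.
  destruct l as [|[k a] l]; [congruence|]. intros _ H.
  destruct (H (k, a) (or_introl eq_refl)) as [_ [E _]]. simpl in E.
  rewrite conv_list_cons, conv_0, E. ring.
Qed.

(** The expansion of a product of [m] normalized cusp forms starts with [q^m]. *)
Lemma cusp_list_1 l : (forall x, In x l -> eigen_coef (fst x) (snd x)) ->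
  conv_list l 1%nat = if Nat.eqb (length l) 1 then 1 else 0.
Proof.
  destruct l as [|[k a] l]; intros H; [reflexivity|].
  destruct (H (k, a) (or_introl eq_refl)) as [_ [E0 [E1 _]]]. cbn [fst snd] in *.
  rewrite conv_list_cons. destruct l as [|x l].
  - simpl. rewrite conv_unit_r. exact E1.
  - rewrite conv_1, E0, cusp_list_0; [simpl; ring|discriminate|]. intros; apply H; simpl; auto.
Qed.

Lemma eigen_coef_le k a N j : eigen_coef k a -> (j <= N)%nat ->
  (Cmod (a j) <= INR (S N) * sqrt (INR N) ^ k)%R.
Proof.
  intros [_ [E0 [_ [_ H]]]] Hj. destruct j as [|j].
  - rewrite E0, Cmod_0. apply Rmult_le_pos; [apply pos_INR|apply pow_le, sqrt_pos].
  - eapply Rle_trans; [apply H; lia|]. apply Rmult_le_compat.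
    + apply pos_INR.
    + apply pow_le, sqrt_pos.
    + apply le_INR. lia.
    + apply pow_incr. split; [apply sqrt_pos|]. apply sqrt_le_1_alt, le_INR. exact Hj.
Qed.

(** Each factor costs one [N + 1] for its own bound and one for the number of terms of the
    convolution. The base [sqrt N], set by the largest index that occurs, is what matters: at index
    [N + 1] such terms become negligible as the weight grows. *)
Lemma cusp_list_le_below N l : (forall x, In x l -> eigen_coef (fst x) (snd x)) ->
  forall j, (j <= N)%nat ->
  (Cmod (conv_list l j) <= (INR (S N) * INR (S N)) ^ length l * sqrt (INR N) ^ list_sum (map fst l))%R.
Proof.
  assert (HN : (1 <= INR (S N))%R) by (apply (le_INR 1); lia).
  induction l as [|[k a] l IH]; intros H j Hj.
  - simpl. unfold conv_unit. destruct (Nat.eqb j 0); [rewrite Cmod_1|rewrite Cmod_0]; lra.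
  - rewrite conv_list_cons. assert (Ha := H (k, a) (or_introl eq_refl)). cbn [fst snd] in Ha.
    set (w := list_sum (map fst l)) in *.
    set (V := ((INR (S N) * INR (S N)) ^ length l * sqrt (INR N) ^ w)%R) in *.
    set (U := (INR (S N) * sqrt (INR N) ^ k)%R).
    assert (HU : (0 <= U)%R) by (apply Rmult_le_pos; [lra|apply pow_le, sqrt_pos]).
    assert (HV : (0 <= V)%R) by (apply Rmult_le_pos; apply pow_le; [nra|apply sqrt_pos]).
    eapply Rle_trans.
    + apply (conv_Cmod_le _ _ j U V HU HV).
      * intros i Hi. apply eigen_coef_le; [exact Ha|lia].
      * intros i Hi. apply IH; [|lia]. intros; apply H; simpl; auto.
    + apply Rle_trans with (INR (S N) * (U * V))%R.
      * apply Rmult_le_compat_r; [now apply Rmult_le_pos|]. apply le_INR. lia.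
      * right. unfold U, V. change (list_sum (map fst ((k, a) :: l))) with (k + w)%nat.
        rewrite pow_add. simpl length. rewrite <- tech_pow_Rmult. ring.
Qed.

(** Since cusp forms have no constant term, with two factors only coefficients of index
    smaller than [N + 1] enter. *)
Lemma cusp_list_le_two N l : (2 <= length l)%nat -> (forall x, In x l -> eigen_coef (fst x) (snd x)) ->
  (Cmod (conv_list l (S N))
    <= 2 * (INR (S N) * INR (S N)) ^ length l * sqrt (INR N) ^ list_sum (map fst l))%R.
Proof.
  assert (HN : (1 <= INR (S N))%R) by (apply (le_INR 1); lia).
  intros Hlen H. destruct l as [|[k a] l]; [simpl in Hlen; lia|].
  assert (Hl : forall x, In x l -> eigen_coef (fst x) (snd x)) by (intros; apply H; simpl; auto).
  rewrite conv_list_cons. assert (Ha := H (k, a) (or_introl eq_refl)). cbn [fst snd] in Ha.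
  set (w := list_sum (map fst l)) in *.
  set (V := ((INR (S N) * INR (S N)) ^ length l * sqrt (INR N) ^ w)%R) in *.
  set (U := (INR (S N) * sqrt (INR N) ^ k)%R).
  assert (HU : (0 <= U)%R) by (apply Rmult_le_pos; [lra|apply pow_le, sqrt_pos]).
  assert (HV : (0 <= V)%R) by (apply Rmult_le_pos; apply pow_le; [nra|apply sqrt_pos]).
  assert (HUV : (0 <= U * V)%R) by now apply Rmult_le_pos.
  unfold conv. apply Rle_trans with (INR (S (S N)) * (U * V))%R.
  - rewrite <- (length_seq (S (S N)) 0) at 2. apply Cmod_Csum_le. intros j Hj. apply in_seq in Hj.
    destruct (Nat.eq_dec j 0) as [->|Hj0].
    { destruct Ha as [_ [E0 _]]. rewrite E0, Cmult_0_l, Cmod_0. exact HUV. }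
    destruct (Nat.eq_dec j (S N)) as [->|HjN].
    { rewrite Nat.sub_diag, cusp_list_0, Cmult_0_r, Cmod_0; [exact HUV| |exact Hl].
      intros ->. simpl in Hlen. lia. }
    rewrite Cmod_mult. apply Rmult_le_compat; try apply Cmod_ge_0.
    + apply eigen_coef_le; [exact Ha|lia].
    + apply cusp_list_le_below; [exact Hl|lia].
  (* The [N + 2] terms are counted as at most [2 (N + 1)], to match the shape of the constant. *)
  - apply Rle_trans with (2 * INR (S N) * (U * V))%R.
    + apply Rmult_le_compat_r; [exact HUV|]. rewrite (S_INR (S N)). lra.
    + right. unfold U, V. change (list_sum (map fst ((k, a) :: l))) with (k + w)%nat.
      rewrite pow_add. simpl length. rewrite <- tech_pow_Rmult. ring.
Qed.

(** * The left-hand side at a fixed index *)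

Definition term_coef (n m k : nat) (c : nat -> C) : Prop :=
  exists le lf, length le = n /\ length lf = m /\
    (forall x, In x le -> eis_coef (fst x) (snd x)) /\
    (forall x, In x lf -> eigen_coef (fst x) (snd x)) /\
    (list_sum (map fst le) + list_sum (map fst lf) = k)%nat /\
    c = conv (conv_list le) (conv_list lf).

(** The leading term pairs the constant term 1 of the Eisenstein product with the cuspidal
    coefficient at [N + 1]; all other terms use cuspidal indices up to [N]. The first summand
    carries the absolute constant 1, while [K] may depend on [N], [n] and [m]. *)
Lemma term_coef_le N n m : (1 <= N)%nat -> (2 <= n + m)%nat -> exists K, (0 <= K)%R /\
  forall k c, term_coef n m k c ->
  (Cmod (c (S N)) <= sqrt (INR (S N)) ^ k / INR (S N) + K * sqrt (INR N) ^ k)%R.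
Proof.
  intros HN Hnm. destruct (eis_list_le (S N) n) as [D [HD HDl]].
  assert (HN1 : (1 <= INR N)%R) by (apply (le_INR 1); lia).
  assert (HSN : (1 <= INR (S N))%R) by (apply (le_INR 1); lia).
  assert (Hs : (1 <= sqrt (INR N))%R) by (rewrite <- sqrt_1; apply sqrt_le_1_alt; lra).
  set (Km := ((INR (S N) * INR (S N)) ^ m)%R).
  assert (HKm : (1 <= Km)%R) by (apply pow_R1_Rle; nra).
  exists (2 * Km + INR (S N) * (D * Km))%R. split; [assert (0 <= D * Km)%R by nra; nra|].
  intros k c [le [lf [Hle [Hlf [He [Hf [Hk ->]]]]]]].
  set (u := list_sum (map fst le)) in *. set (v := list_sum (map fst lf)) in *.
  set (s := sqrt (INR N)) in *.
  assert (Hsk : (s ^ v <= s ^ k)%R) by (apply Rle_pow; [exact Hs|lia]).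
  assert (Hsv : (1 <= s ^ v)%R) by (now apply pow_R1_Rle).
  assert (HX : (0 < sqrt (INR (S N)) ^ k / INR (S N))%R).
  { apply Rdiv_lt_0_compat; [apply pow_lt, sqrt_lt_R0; lra|lra]. }
  assert (HF : (Cmod (conv_list lf (S N)) <= sqrt (INR (S N)) ^ k / INR (S N) + 2 * Km * s ^ k)%R).
  { destruct (Nat.le_gt_cases 2 m) as [Hm|Hm].
    - eapply Rle_trans; [apply cusp_list_le_two; [lia|exact Hf]|]. rewrite Hlf. fold Km v s.
      assert (2 * Km * s ^ v <= 2 * Km * s ^ k)%R by (apply Rmult_le_compat_l; lra). lra.
    - assert (H2 : (0 <= 2 * Km * s ^ k)%R) by (apply Rmult_le_pos; lra).
      destruct lf as [|[v' a] [|y lf]]; [| |simpl in Hlf; lia].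
      + change (conv_list nil (S N)) with (RtoC 0). rewrite Cmod_0. lra.
      + simpl conv_list. rewrite conv_unit_r.
        destruct (Hf (v', a) (or_introl eq_refl)) as [_ [_ [_ [_ Hb]]]]. cbn [fst snd] in Hb.
        assert (Hv : v = v') by (unfold v; simpl; lia).
        assert (Hu := eis_list_weight le He). fold u in Hu.
        simpl in Hlf. eapply Rle_trans; [apply (Hb (S N)); lia|].
        enough (INR (S N) * sqrt (INR (S N)) ^ v' <= sqrt (INR (S N)) ^ k / INR (S N))%R by lra.
        set (x := sqrt (INR (S N))) in *.
        assert (Hx1 : (1 <= x)%R) by (unfold x; rewrite <- sqrt_1; apply sqrt_le_1_alt; lra).
        assert (Hx2 : (x * x = INR (S N))%R) by (apply sqrt_sqrt; lra).
        apply Rmult_le_reg_r with (INR (S N)); [lra|].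
        replace (x ^ k / INR (S N) * INR (S N))%R with (x ^ k)%R by (field; lra).
        (* With [N + 1 = x^2], one such factor comes from the bound of the coefficient and one from
           the denominator; together they use up the weight 4 of an Eisenstein factor, which exists
           because [m = 1] and [n + m >= 2]. *)
        apply Rle_trans with (x ^ (v' + 4))%R; [|apply Rle_pow; [exact Hx1|lia]].
        right. rewrite <- Hx2, pow_add. simpl. ring. }
  unfold conv. rewrite <- cons_seq, Csum_cons, eis_list_0, Nat.sub_0_r, Cmult_1_l by exact He.
  eapply Rle_trans; [apply Cmod_triangle|].
  assert (HR : (Cmod (Csum (fun j => conv_list le j * conv_list lf (S N - j)%nat)%C (seq 1 (S N)))
    <= INR (S N) * (D * (Km * s ^ v)))%R).
  { rewrite <- (length_seq (S N) 1) at 2. apply Cmod_Csum_le. intros j Hj. apply in_seq in Hj.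
    rewrite Cmod_mult. apply Rmult_le_compat; try apply Cmod_ge_0.
    - apply HDl; [exact Hle|exact He|lia].
    - unfold Km, v. rewrite <- Hlf. apply cusp_list_le_below; [exact Hf|lia]. }
  assert (HR' : (INR (S N) * (D * (Km * s ^ v)) <= INR (S N) * (D * Km) * s ^ k)%R).
  { replace (INR (S N) * (D * (Km * s ^ v)))%R with (INR (S N) * (D * Km) * s ^ v)%R by ring.
    apply Rmult_le_compat_l; [|exact Hsk]. assert (0 <= D * Km)%R by nra. nra. }
  lra.
Qed.

Lemma lhs_coef_le (A : nat -> C) (n m : nat -> nat) N l : (1 <= N)%nat ->
  (forall i, In i l -> (2 <= n i + m i)%nat) -> exists K, (0 <= K)%R /\
  forall k c, (forall i, In i l -> term_coef (n i) (m i) k (c i)) ->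
  (Cmod (Csum (fun i => A i * c i (S N))%C l)
    <= Rsum (fun i => Cmod (A i)) l * (sqrt (INR (S N)) ^ k / INR (S N)) + K * sqrt (INR N) ^ k)%R.
Proof.
  intros HN. induction l as [|i l IH]; intros Hnm.
  - exists 0%R. split; [lra|]. intros k c _. rewrite Csum_nil, Cmod_0. unfold Rsum; simpl. lra.
  - destruct IH as [K [HK IH]]; [intros; apply Hnm; simpl; auto|].
    destruct (term_coef_le N (n i) (m i) HN (Hnm i (or_introl eq_refl))) as [K' [HK' H']].
    exists (Cmod (A i) * K' + K)%R. assert (HA := Cmod_ge_0 (A i)). split; [nra|].
    intros k c Hc. rewrite Csum_cons, Rsum_cons.
    eapply Rle_trans; [apply Cmod_triangle|]. rewrite Cmod_mult.
    assert (H1 := H' k (c i) (Hc i (or_introl eq_refl))).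
    assert (H2 := IH k c ltac:(intros; apply Hc; simpl; auto)).
    apply (Rmult_le_compat_l (Cmod (A i))) in H1; [|exact HA]. lra.
Qed.

Lemma pow_ratio_eventually_le x y K : (0 <= x < y)%R -> exists k0, forall k, (k0 <= k)%nat ->
  (K * x ^ k <= y ^ k)%R.
Proof.
  intros Hxy. destruct (Rle_lt_dec K 0) as [HK|HK].
  - exists 0%nat. intros k _. assert (H1 : (0 <= x ^ k)%R) by (apply pow_le; lra).
    assert (H2 : (0 <= y ^ k)%R) by (apply pow_le; lra). nra.
  - assert (Hxy1 : (0 <= x / y < 1)%R).
    { split; [apply Rmult_le_pos; [lra|apply Rlt_le, Rinv_0_lt_compat; lra]|].
      apply Rmult_lt_reg_r with y; [lra|]. replace (x / y * y)%R with x by (field; lra). lra. }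
    destruct (pow_lt_1_zero (x / y) ltac:(rewrite Rabs_pos_eq; lra) (/ K) ltac:(now apply Rinv_0_lt_compat))
      as [k0 Hk0].
    exists k0. intros k Hk. specialize (Hk0 k Hk). rewrite Rabs_pos_eq in Hk0 by (apply pow_le; lra).
    assert (Hyk : (0 < y ^ k)%R) by (apply pow_lt; lra).
    unfold Rdiv in Hk0. rewrite Rpow_mult_distr, pow_inv in Hk0.
    apply (Rmult_lt_compat_r (K * y ^ k)) in Hk0; [|now apply Rmult_lt_0_compat].
    replace (x ^ k * / y ^ k * (K * y ^ k))%R with (K * x ^ k)%R in Hk0 by (field; lra).
    replace (/ K * (K * y ^ k))%R with (y ^ k)%R in Hk0 by (field; lra). lra.
Qed.

(** As [sqrt (N - 1) < sqrt N], the lower-order part is eventually absorbed at the price of adding 1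
    to the constant, which depends on the [A_i] alone. *)
Lemma lhs_coef_eventually_le (A : nat -> C) (n m : nat -> nat) N l : (2 <= N)%nat ->
  (forall i, In i l -> (2 <= n i + m i)%nat) -> exists k0,
  forall k c, (k0 <= k)%nat -> (forall i, In i l -> term_coef (n i) (m i) k (c i)) ->
  (Cmod (Csum (fun i => A i * c i N)%C l)
    <= (Rsum (fun i => Cmod (A i)) l + 1) * (sqrt (INR N) ^ k / INR N))%R.
Proof.
  intros HN Hnm. destruct N as [|N]; [lia|].
  destruct (lhs_coef_le A n m N l ltac:(lia) Hnm) as [K [HK HKc]].
  assert (HNN : (INR N < INR (S N))%R) by (apply lt_INR; lia).
  assert (HN0 := pos_INR N).
  destruct (pow_ratio_eventually_le (sqrt (INR N)) (sqrt (INR (S N))) (K * INR (S N))) as [k0 Hk0].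
  { split; [apply sqrt_pos|]. apply sqrt_lt_1_alt. lra. }
  exists k0. intros k c Hk Hc. specialize (Hk0 k Hk).
  eapply Rle_trans; [exact (HKc k c Hc)|].
  enough (K * sqrt (INR N) ^ k <= sqrt (INR (S N)) ^ k / INR (S N))%R by lra.
  apply Rmult_le_reg_r with (INR (S N)); [lra|].
  replace (sqrt (INR (S N)) ^ k / INR (S N) * INR (S N))%R with (sqrt (INR (S N)) ^ k)%R by (field; lra). lra.
Qed.

(** * Cuspidal [h] *)

Lemma prime_above B : exists p, (B < p)%nat /\ is_prime p.
Proof.
  assert (Hdiv : forall M, (2 <= M)%nat -> exists p, is_prime p /\ Nat.divide p M).
  { induction M as [M IH] using (well_founded_induction lt_wf). intros HM.
    destruct (classic (is_prime M)) as [H|H]; [exists M; split; [exact H|apply Nat.divide_refl]|].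
    assert (Hd : exists d, (1 <= d)%nat /\ Nat.divide d M /\ d <> 1%nat /\ d <> M).
    { apply NNPP. intros Hn. apply H. split; [exact HM|]. intros d Hd1 Hd2.
      apply NNPP. intros Hd3. apply Hn. exists d. repeat split; auto. }
    destruct Hd as [d [H1 [H2 [H3 H4]]]].
    assert (Hle := Nat.divide_pos_le d M ltac:(lia) H2).
    destruct (IH d ltac:(lia) ltac:(lia)) as [p [Hp1 Hp2]].
    exists p. split; [exact Hp1|]. now apply Nat.divide_trans with d. }
  assert (HF := lt_O_fact B).
  (* Euclid: a prime up to [B] divides [B!], hence not [B! + 1]. *)
  destruct (Hdiv (fact B + 1)%nat ltac:(lia)) as [p [Hp Hpd]].
  exists p. split; [|exact Hp]. destruct (Nat.le_gt_cases p B) as [H|H]; [exfalso|exact H].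
  assert (Hpf : Nat.divide p (fact B)).
  { destruct Hp as [Hp _]. clear -H Hp. induction H as [|B H IH].
    - destruct p as [|p]; [lia|]. exists (fact p). rewrite fact_simpl. lia.
    - rewrite fact_simpl. now apply Nat.divide_mul_r. }
  assert (H1 : Nat.divide p 1) by (apply (Nat.divide_add_cancel_r p (fact B)); assumption).
  apply Nat.divide_1_r in H1. destruct Hp as [Hp _]. lia.
Qed.

(** The relation [a(p)^2 = a(p^2) + p^(k-1)] forbids [a(p)] and [a(p^2)] to be both small. *)
Lemma cuspidal_case (A : nat -> C) (n m : nat -> nat) l :
  (forall i, In i l -> (2 <= n i + m i)%nat) -> exists k0,
  forall k b c, (k0 <= k)%nat -> eigen_coef k b ->
  (forall i, In i l -> term_coef (n i) (m i) k (c i)) ->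
  ~ forall N, b N = Csum (fun i => A i * c i N) l.
Proof.
  intros Hnm. set (T := (Rsum (fun i => Cmod (A i)) l + 1)%R).
  assert (HT : (1 <= T)%R).
  { unfold T. assert (0 <= Rsum (fun i => Cmod (A i)) l)%R; [|lra]. apply Rsum_ge0. intros; apply Cmod_ge_0. }
  (* The bounds [|a(p)| <= T p^(k/2-1)] and [|a(p^2)| <= T p^(k-2)] turn the relation into
     [p^(k-1) <= (T^2 + T) p^(k-2)], which fails for [p > T^2 + T]. *)
  destruct (INR_unbounded (T * T + T)) as [B HB].
  destruct (prime_above B) as [p [HBp Hp]].
  assert (Hp2 : (2 <= p)%nat) by apply Hp.
  destruct (lhs_coef_eventually_le A n m p l Hp2 Hnm) as [k1 Hk1].
  destruct (lhs_coef_eventually_le A n m (p * p) l ltac:(nia) Hnm) as [k2 Hk2].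
  exists (Nat.max k1 k2). intros k b c Hk Hb Hc HN.
  specialize (Hk1 k c ltac:(lia) Hc). specialize (Hk2 k c ltac:(lia) Hc).
  rewrite <- HN in Hk1, Hk2. fold T in Hk1, Hk2.
  destruct Hb as [Hk0 [_ [Hb1 [Hb2 _]]]].
  assert (E := Hb2 p p ltac:(lia)). rewrite hecke_coef_prime, Hb1, Cmult_1_r in E by assumption.
  set (P := INR p) in *.
  assert (HP : (T * T + T < P)%R) by (eapply Rlt_trans; [exact HB|apply lt_INR; exact HBp]).
  assert (HP0 : (1 <= P)%R) by nra.
  rewrite mult_INR in Hk2. fold P in Hk2. rewrite sqrt_square in Hk2 by lra.
  assert (E2 : (P ^ (k - 1) <= Cmod (b p) * Cmod (b p) + Cmod (b (p * p)%nat))%R).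
  { replace (P ^ (k - 1))%R with (Cmod (b p * b p + - b (p * p)%nat)).
    - eapply Rle_trans; [apply Cmod_triangle|]. rewrite Cmod_opp, Cmod_mult. lra.
    - rewrite <- E. replace (b (p * p)%nat + RtoC P ^ (k - 1) + - b (p * p)%nat) with (RtoC P ^ (k - 1)) by ring.
      unfold P. now rewrite Cmod_pow, Cmod_INR. }
  set (s := sqrt P) in *. assert (Hss : (s * s = P)%R) by (apply sqrt_sqrt; lra).
  assert (Hsk : (s ^ k * s ^ k = P ^ k)%R) by (rewrite <- Rpow_mult_distr, Hss; reflexivity).
  assert (HPk : (0 < P ^ k)%R) by (apply pow_lt; lra).
  assert (HPk1 : (P ^ k = P * P ^ (k - 1))%R).
  { destruct k as [|k]; [lia|]. simpl. now rewrite Nat.sub_0_r. }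
  assert (Hsq : (Cmod (b p) * Cmod (b p) <= (T * (s ^ k / P)) * (T * (s ^ k / P)))%R).
  { apply Rmult_le_compat; auto using Cmod_ge_0. }
  assert (Hfin : (P ^ (k - 1) <= (T * T + T) * (P ^ k / (P * P)))%R).
  { eapply Rle_trans; [exact E2|].
    replace ((T * T + T) * (P ^ k / (P * P)))%R
      with (T * (s ^ k / P) * (T * (s ^ k / P)) + T * (P ^ k / (P * P)))%R; [lra|].
    rewrite <- Hsk. field. lra. }
  rewrite HPk1 in Hfin. assert (HPk2 : (0 < P ^ (k - 1))%R) by (apply pow_lt; lra).
  apply (Rmult_le_compat_r (P / P ^ (k - 1))) in Hfin; [|apply Rlt_le, Rdiv_lt_0_compat; lra].
  replace (P ^ (k - 1) * (P / P ^ (k - 1)))%R with P in Hfin by (field; lra).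
  replace ((T * T + T) * (P * P ^ (k - 1) / (P * P)) * (P / P ^ (k - 1)))%R with (T * T + T)%R in Hfin by (field; lra).
  lra.
Qed.

(** * Linear relations between Eisenstein constants *)

(** Lists the ways to single out one entry. Being finite, it allows one threshold to be taken over
    all cases of the induction below. *)
Fixpoint removals {T : Type} (l : list T) : list (T * list T) :=
  match l with
  | nil => nil
  | x :: l => (x, l) :: map (fun y => (fst y, x :: snd y)) (removals l)
  end.

Lemma removals_length (T : Type) (l : list T) x l' : In (x, l') (removals l) -> length l = S (length l').
Proof.
  revert x l'. induction l as [|y l IH]; intros x l' H; [contradiction|].
  simpl in H. destruct H as [H|H].
  - injection H as <- <-. reflexivity.
  - apply in_map_iff in H. destruct H as [[x1 l1] [H1 H2]]. injection H1 as <- <-.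
    simpl. f_equal. exact (IH _ _ H2).
Qed.

Lemma removals_perm (T : Type) (l : list T) : forall x l', Permutation (x :: l') l ->
  exists l'', In (x, l'') (removals l) /\ Permutation l' l''.
Proof.
  induction l as [|y l IH]; intros x l' HP.
  - apply Permutation_length in HP. discriminate.
  - assert (Hx : In x (y :: l)) by (apply (Permutation_in _ HP); simpl; auto).
    destruct (classic (x = y)) as [->|Hne].
    + exists l. split; [simpl; auto|]. exact (Permutation_cons_inv HP).
    + destruct Hx as [Hx|Hx]; [congruence|].
      assert (Hy : In y l').
      { assert (H : In y (x :: l')) by (apply (Permutation_in _ (Permutation_sym HP)); simpl; auto).
        destruct H; [congruence|assumption]. }
      destruct (in_split y l' Hy) as [l1 [l2 ->]].
      destruct (IH x (l1 ++ l2)) as [l'' [H1 H2]].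
      { apply (Permutation_cons_inv (a := y)). refine (Permutation_trans _ HP).
        apply (Permutation_trans (perm_swap x y (l1 ++ l2))). apply perm_skip, Permutation_middle. }
      exists (y :: l''). split.
      * simpl. right. apply in_map_iff. exists (x, l''). auto.
      * apply (Permutation_trans (Permutation_sym (Permutation_middle l1 l2 y))). now apply perm_skip.
Qed.

Lemma uniform_bound (X : Type) (P : X -> nat -> Prop) (l : list X) :
  (forall x K K', P x K -> (K <= K')%nat -> P x K') -> (forall x, In x l -> exists K, P x K) ->
  exists K, forall x, In x l -> P x K.
Proof.
  intros Hm. induction l as [|x l IH]; intros H; [exists 0%nat; contradiction|].
  destruct IH as [K HK]; [intros; apply H; simpl; auto|].
  destruct (H x (or_introl eq_refl)) as [K' HK']. exists (Nat.max K K').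
  intros y [<-|Hy]; [apply (Hm x K')|apply (Hm y K)]; auto; lia.
Qed.

Lemma not_NoDup_map (S T : Type) (g : S -> T) (l : list S) : ~ NoDup (map g l) ->
  exists x y l', Permutation l (x :: y :: l') /\ g x = g y.
Proof.
  induction l as [|x l IH]; intros H; [exfalso; apply H; constructor|].
  destruct (classic (In (g x) (map g l))) as [Hin|Hin].
  - apply in_map_iff in Hin. destruct Hin as [y [E Hy]].
    destruct (in_split y l Hy) as [l1 [l2 ->]]. exists x, y, (l1 ++ l2). split; [|congruence].
    apply perm_skip, Permutation_sym, Permutation_middle.
  - destruct IH as [a [b [l' [H1 H2]]]].
    + intros Hnd. apply H. simpl. now constructor.
    + exists a, b, (x :: l'). split; [|exact H2].
      apply (Permutation_trans (perm_skip x H1)).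
      apply (Permutation_trans (perm_swap a x (b :: l'))). apply perm_skip, perm_swap.
Qed.

Lemma exists_minimal (T : Type) (g : T -> nat) (l : list T) : l <> nil ->
  exists x, In x l /\ forall y, In y l -> (g x <= g y)%nat.
Proof.
  induction l as [|x l IH]; intros H; [congruence|]. destruct l as [|z l].
  - exists x. split; [simpl; auto|]. intros y [<-|[]]. lia.
  - destruct IH as [w [Hw Hmin]]; [discriminate|].
    destruct (Nat.le_gt_cases (g x) (g w)) as [Hc|Hc].
    + exists x. split; [simpl; auto|]. intros y [<-|Hy]; [lia|]. specialize (Hmin y Hy). lia.
    + exists w. split; [right; exact Hw|]. intros y [<-|Hy]; [lia|]. now apply Hmin.
Qed.

Lemma nonzero_lower_bound (l : list C) : (forall c, In c l -> c <> 0) ->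
  exists mu, (0 < mu)%R /\ forall c, In c l -> (mu <= Cmod c)%R.
Proof.
  induction l as [|c l IH]; intros H; [exists 1%R; split; [lra|contradiction]|].
  destruct IH as [mu [H1 H2]]; [intros; apply H; simpl; auto|].
  assert (Hc : (0 < Cmod c)%R) by (apply Cmod_gt_0, H; simpl; auto).
  exists (Rmin mu (Cmod c)). split; [now apply Rmin_glb_lt|].
  intros d [<-|Hd]; [apply Rmin_r|]. eapply Rle_trans; [apply Rmin_l|auto].
Qed.

Lemma Rsum_perm (T : Type) (F : T -> R) l l' : Permutation l l' -> Rsum F l = Rsum F l'.
Proof.
  induction 1 as [|x l l' _ IH|x y l|l l' l'' _ IH1 _ IH2].
  - reflexivity.
  - now rewrite !Rsum_cons, IH.
  - rewrite !Rsum_cons. ring.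
  - congruence.
Qed.

Lemma Rsum_map (S T : Type) (g : S -> T) (F : T -> R) l : Rsum F (map g l) = Rsum (fun x => F (g x)) l.
Proof. unfold Rsum. now rewrite map_map. Qed.

Definition eis_combination (L : list (C * nat)) : C :=
  Csum (fun x => fst x * eisenstein_const (snd x)) L.

Lemma eis_combination_le (L : list (C * nat)) X :
  (forall x, In x L -> (Cmod (eisenstein_const (snd x)) <= X)%R) ->
  (Cmod (eis_combination L) <= Rsum Cmod (map fst L) * X)%R.
Proof.
  intros H. eapply Rle_trans; [apply Cmod_Csum|]. rewrite Rsum_map, <- Rsum_scal.
  apply Rsum_le. intros x Hx. rewrite Cmod_mult.
  apply Rmult_le_compat_l; [apply Cmod_ge_0|now apply H].
Qed.

(** The multipliers [cs] and the constant [B] are fixed and the weights are free, so one [K] serves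
    all of them. Working up to permutation lets any entry be extracted. The strict bound [snd x < k]
    keeps [C_k] apart from the terms of the combination. *)
Definition no_relation (cs : list C) (B : C) (K : nat) : Prop :=
  forall k L, (K <= k)%nat -> Permutation (map fst L) cs ->
  (forall x, In x L -> (2 <= snd x < k)%nat) -> B + eis_combination L <> eisenstein_const k.

Lemma no_relation_mono cs B K K' : no_relation cs B K -> (K <= K')%nat -> no_relation cs B K'.
Proof. intros H HK k L Hk. apply H. lia. Qed.

(** The Eisenstein constants decay superexponentially. Hence a constant [B <> 0] cannot be
    compensated by terms of large weight, and among terms of distinct large weights the one of
    smallest weight dominates. Terms of small weight are absorbed in [B], and terms of equal
    weight are merged. *)
Lemma eis_no_relation (T : nat) : forall (cs : list C) (B : C), (length cs <= T)%nat ->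
  exists K, no_relation cs B K.
Proof.
  induction T as [T IH] using (well_founded_induction lt_wf). intros cs B HT.
  set (S := Rsum Cmod cs).
  assert (HS : (0 <= S)%R) by (apply Rsum_ge0; intros; apply Cmod_ge_0).
  (* If every other constant is at most [X], the terms to be beaten, [C_k] included, sum to at most
     [(1 + S) X]. The factor [2 (1 + S)] makes this half of the dominant term. *)
  assert (HN0 : exists N0, (2 <= N0)%nat /\
    (B <> 0 -> forall a, (N0 <= a)%nat -> (Cmod (eisenstein_const a) * (2 * (1 + S)) <= Cmod B)%R) /\
    ((forall c, In c cs -> c <> 0) -> forall c a b, In c cs -> (N0 <= a)%nat -> (a < b)%nat ->
      (Cmod (eisenstein_const b) * (2 * (1 + S)) <= Cmod c * Cmod (eisenstein_const a))%R)).
  { assert (HB : exists N1, (2 <= N1)%nat /\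
      (B <> 0 -> forall a, (N1 <= a)%nat -> (Cmod (eisenstein_const a) * (2 * (1 + S)) <= Cmod B)%R)).
    { destruct (classic (B = 0)) as [HB|HB]; [exists 2%nat; split; [lia|tauto]|].
      assert (HBp : (0 < Cmod B)%R) by (now apply Cmod_gt_0).
      destruct (eisenstein_const_small (Cmod B / (2 * (1 + S)))) as [N1 [H1 H2]]; [apply Rdiv_lt_0_compat; lra|].
      exists N1. split; [exact H1|]. intros _ a Ha. specialize (H2 a Ha).
      apply (Rmult_le_compat_r (2 * (1 + S))) in H2; [|lra].
      replace (Cmod B / (2 * (1 + S)) * (2 * (1 + S)))%R with (Cmod B) in H2 by (field; lra). exact H2. }
    assert (HC : exists N2, (2 <= N2)%nat /\
      ((forall c, In c cs -> c <> 0) -> forall c a b, In c cs -> (N2 <= a)%nat -> (a < b)%nat ->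
      (Cmod (eisenstein_const b) * (2 * (1 + S)) <= Cmod c * Cmod (eisenstein_const a))%R)).
    { destruct (classic (forall c, In c cs -> c <> 0)) as [Hc|Hc]; [|exists 2%nat; split; [lia|tauto]].
      destruct (nonzero_lower_bound cs Hc) as [mu [Hmu Hmuc]].
      destruct (eisenstein_const_ratio (mu / (2 * (1 + S)))) as [N2 [H1 H2]]; [apply Rdiv_lt_0_compat; lra|].
      exists N2. split; [exact H1|]. intros _ c a b Hin Ha Hab. specialize (H2 a b Ha Hab).
      apply (Rmult_le_compat_r (2 * (1 + S))) in H2; [|lra].
      eapply Rle_trans; [exact H2|].
      replace (mu / (2 * (1 + S)) * Cmod (eisenstein_const a) * (2 * (1 + S)))%R
        with (mu * Cmod (eisenstein_const a))%R by (field; lra).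
      apply Rmult_le_compat_r; [apply Cmod_ge_0|now apply Hmuc]. }
    destruct HB as [N1 [HN1 HB]], HC as [N2 [HN2 HC]]. exists (Nat.max N1 N2).
    split; [lia|]. split.
    - intros HBn a Ha. apply HB; [exact HBn|lia].
    - intros Hcs c a b Hin Ha Hab. apply HC; auto; lia. }
  destruct HN0 as [N0 [HN0 [HB HC]]].
  (* Three thresholds follow, each from the induction hypothesis over finitely many shorter lists:
     [K1] for a term of weight below [N0] moved into [B], [K2] for two multipliers merged, [K3] for
     a zero multiplier dropped. Zero multipliers can arise from cancellation in a merge. *)
  assert (HK1 : exists K1, forall o, In o (list_prod (removals cs) (seq 0 N0)) ->
    no_relation (snd (fst o)) (B + fst (fst o) * eisenstein_const (snd o)) K1).
  { apply (uniform_bound _ (fun o => no_relation (snd (fst o)) (B + fst (fst o) * eisenstein_const (snd o)))).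
    - intros o K K'. apply no_relation_mono.
    - intros [[c cs'] a] Ho. apply in_prod_iff in Ho. destruct Ho as [Ho _].
      apply removals_length in Ho. cbn [fst snd]. apply (IH (length cs')); lia. }
  assert (HK2 : exists K2, forall o, In o (removals cs) -> forall o', In o' (removals (snd o)) ->
    no_relation ((fst o + fst o') :: snd o') B K2).
  { apply (uniform_bound _ (fun o K => forall o', In o' (removals (snd o)) -> no_relation ((fst o + fst o') :: snd o') B K)).
    - intros o K K' H HKK o' Ho'. apply (no_relation_mono _ _ K); auto.
    - intros [c cs'] Ho. apply removals_length in Ho. cbn [fst snd].
      apply (uniform_bound _ (fun o' => no_relation ((c + fst o') :: snd o') B)).
      + intros o' K K'. apply no_relation_mono.
      + intros [c' cs''] Ho'. apply removals_length in Ho'. cbn [fst snd].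
        apply (IH (length cs')); simpl; lia. }
  assert (HK3 : exists K3, forall o, In o (removals cs) -> no_relation (snd o) B K3).
  { apply (uniform_bound _ (fun o => no_relation (snd o) B)).
    - intros o K K'. apply no_relation_mono.
    - intros [c cs'] Ho. apply removals_length in Ho. cbn [fst snd]. apply (IH (length cs')); lia. }
  destruct HK1 as [K1 HK1], HK2 as [K2 HK2], HK3 as [K3 HK3].
  exists (N0 + K1 + K2 + K3)%nat. intros k L Hk HP Hr.
  destruct (classic (exists x, In x L /\ (snd x < N0)%nat)) as [[[c a] [Hx Ha]]|Hlarge].
  { destruct (in_split _ _ Hx) as [L1 [L2 HL]].
    assert (HLp : Permutation L ((c, a) :: L1 ++ L2)) by (rewrite HL; apply Permutation_sym, Permutation_middle).
    destruct (removals_perm _ cs c (map fst (L1 ++ L2))) as [cs' [Hcs' HP']].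
    { refine (Permutation_trans _ HP). exact (Permutation_sym (Permutation_map fst HLp)). }
    intros E. apply (HK1 ((c, cs'), a) ltac:(apply in_prod_iff; split; [exact Hcs'|apply in_seq; simpl in Ha; lia]) k (L1 ++ L2)).
    - lia.
    - exact HP'.
    - intros x Hx'. apply Hr. apply (Permutation_in _ (Permutation_sym HLp)). simpl; auto.
    - rewrite <- E. unfold eis_combination. rewrite (Csum_perm _ _ _ _ HLp), Csum_cons. cbn [fst snd]. ring. }
  assert (HlargeL : forall x, In x L -> (N0 <= snd x)%nat).
  { intros x Hx. destruct (Nat.le_gt_cases N0 (snd x)); [assumption|]. exfalso. eauto. }
  destruct (classic (NoDup (map snd L))) as [Hnd|Hnd].
  2:{ destruct (not_NoDup_map _ _ snd L Hnd) as [[c a] [[c' a'] [L' [HLp Ea]]]]. simpl in Ea. subst a'.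
    destruct (removals_perm _ cs c (c' :: map fst L')) as [cs' [Hcs' HP']].
    { refine (Permutation_trans _ HP). exact (Permutation_sym (Permutation_map fst HLp)). }
    destruct (removals_perm _ cs' c' (map fst L') HP') as [cs'' [Hcs'' HP'']].
    intros E. apply (HK2 (c, cs') Hcs' (c', cs'') Hcs'' k ((c + c', a) :: L')).
    - lia.
    - simpl. now apply perm_skip.
    - intros x [<-|Hx]; simpl.
      + apply (Hr (c, a)). apply (Permutation_in _ (Permutation_sym HLp)). simpl; auto.
      + apply Hr. apply (Permutation_in _ (Permutation_sym HLp)). simpl; auto.
    - rewrite <- E. unfold eis_combination. rewrite (Csum_perm _ _ _ _ HLp), !Csum_cons. cbn [fst snd]. ring. }
  destruct (classic (forall c, In c cs -> c <> 0)) as [Hnz|Hz].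
  2:{ assert (Hz' : exists x, In x L /\ fst x = 0).
    { apply NNPP. intros Hn. apply Hz. intros c Hc ->.
      apply (Permutation_in _ (Permutation_sym HP)) in Hc. apply in_map_iff in Hc.
      destruct Hc as [x [Hx1 Hx2]]. eauto. }
    destruct Hz' as [[c a] [Hx Hc]]. simpl in Hc. subst c.
    destruct (in_split _ _ Hx) as [L1 [L2 HL]].
    assert (HLp : Permutation L ((RtoC 0, a) :: L1 ++ L2)) by (rewrite HL; apply Permutation_sym, Permutation_middle).
    destruct (removals_perm _ cs (RtoC 0) (map fst (L1 ++ L2))) as [cs' [Hcs' HP']].
    { refine (Permutation_trans _ HP). exact (Permutation_sym (Permutation_map fst HLp)). }
    intros E. apply (HK3 (RtoC 0, cs') Hcs' k (L1 ++ L2)).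
    - lia.
    - exact HP'.
    - intros x Hx'. apply Hr. apply (Permutation_in _ (Permutation_sym HLp)). simpl; auto.
    - rewrite <- E. unfold eis_combination. rewrite (Csum_perm _ _ _ _ HLp), Csum_cons. cbn [fst snd]. ring. }
  intros E.
  destruct (classic (B = 0)) as [HB0|HB0].
  - subst B. rewrite Cplus_0_l in E.
    assert (HL0 : L <> nil).
    { intros ->. apply (eisenstein_const_neq_0 k ltac:(lia)). rewrite <- E. reflexivity. }
    destruct (exists_minimal _ snd L HL0) as [[c a] [Hx Hmin]]. cbn [snd] in Hmin.
    destruct (in_split _ _ Hx) as [L1 [L2 HL]].
    assert (HLp : Permutation L ((c, a) :: L1 ++ L2)) by (rewrite HL; apply Permutation_sym, Permutation_middle).
    assert (Hdist : forall y, In y (L1 ++ L2) -> (a < snd y)%nat).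
    { intros y Hy. assert (HyL : In y L) by (apply (Permutation_in _ (Permutation_sym HLp)); simpl; auto).
      specialize (Hmin y HyL). destruct (Nat.eq_dec a (snd y)) as [Ey|Ey]; [exfalso|lia].
      apply (Permutation_NoDup (Permutation_map snd HLp)) in Hnd. simpl in Hnd.
      inversion Hnd as [|? ? Hni _]. apply Hni. rewrite Ey. now apply in_map. }
    assert (Hc : In c cs).
    { apply (Permutation_in _ HP). apply (in_map fst) in Hx. exact Hx. }
    assert (HaN := HlargeL _ Hx). assert (Hak := Hr _ Hx). cbn [snd] in HaN, Hak.
    set (Ca := Cmod (eisenstein_const a)).
    assert (HCa : (0 < Ca)%R) by (apply Cmod_gt_0, eisenstein_const_neq_0; lia).
    assert (Hcp : (0 < Cmod c)%R) by (apply Cmod_gt_0, Hnz, Hc).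
    set (X := (Cmod c * Ca / (2 * (1 + S)))%R).
    (* Since [a < k], this covers [C_k] as well as the remaining terms: all are dominated by the
       term of least weight [a]. *)
    assert (HX : forall b, (a < b)%nat -> (Cmod (eisenstein_const b) <= X)%R).
    { intros b Hab. assert (H := HC Hnz c a b Hc HaN Hab). fold Ca in H. unfold X.
      apply Rmult_le_reg_r with (2 * (1 + S))%R; [lra|].
      replace (Cmod c * Ca / (2 * (1 + S)) * (2 * (1 + S)))%R with (Cmod c * Ca)%R by (field; lra). exact H. }
    assert (HR := eis_combination_le (L1 ++ L2) X ltac:(intros y Hy; apply HX, Hdist, Hy)).
    assert (HSR : (Rsum Cmod (map fst (L1 ++ L2)) <= S)%R).
    { unfold S. rewrite <- (Rsum_perm _ _ _ _ HP), (Rsum_perm _ _ _ _ (Permutation_map fst HLp)).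
      change (Rsum Cmod (map fst (L1 ++ L2)) <= Cmod c + Rsum Cmod (map fst (L1 ++ L2)))%R. lra. }
    assert (HXp : (0 < X)%R) by (apply Rdiv_lt_0_compat; [now apply Rmult_lt_0_compat|lra]).
    assert (Hkb := HX k ltac:(lia)).
    assert (Hmain : (Cmod c * Ca <= X + S * X)%R).
    { unfold Ca. rewrite <- Cmod_mult.
      replace (c * eisenstein_const a) with (eisenstein_const k + - eis_combination (L1 ++ L2)).
      - eapply Rle_trans; [apply Cmod_triangle|]. rewrite Cmod_opp. apply Rplus_le_compat; [exact Hkb|].
        eapply Rle_trans; [exact HR|]. apply Rmult_le_compat_r; lra.
      - rewrite <- E. unfold eis_combination. rewrite (Csum_perm _ _ _ _ HLp), Csum_cons. cbn [fst snd]. ring. }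
    assert (HXe : (X * (2 * (1 + S)) = Cmod c * Ca)%R) by (unfold X; field; lra).
    nra.
  - assert (HBp : (0 < Cmod B)%R) by (now apply Cmod_gt_0).
    set (X := (Cmod B / (2 * (1 + S)))%R).
    assert (HX : forall a, (N0 <= a)%nat -> (Cmod (eisenstein_const a) <= X)%R).
    { intros a Ha. assert (H := HB HB0 a Ha). unfold X.
      apply Rmult_le_reg_r with (2 * (1 + S))%R; [lra|].
      replace (Cmod B / (2 * (1 + S)) * (2 * (1 + S)))%R with (Cmod B) by (field; lra). exact H. }
    assert (HR := eis_combination_le L X ltac:(intros y Hy; apply HX, HlargeL, Hy)).
    rewrite (Rsum_perm _ _ _ _ HP) in HR. fold S in HR.
    assert (Hkb := HX k ltac:(lia)).
    assert (Hmain : (Cmod B <= X + S * X)%R).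
    { replace B with (eisenstein_const k + - eis_combination L) by (rewrite <- E; ring).
      eapply Rle_trans; [apply Cmod_triangle|]. rewrite Cmod_opp. now apply Rplus_le_compat. }
    assert (HXe : (X * (2 * (1 + S)) = Cmod B)%R) by (unfold X; field; lra).
    nra.
Qed.

(** * Eisenstein [h] *)

Lemma term_coef_1 n m k c : (2 <= n + m)%nat -> term_coef n m k c ->
  exists ws, length ws = (if Nat.eqb m 0 then n else 0%nat) /\
    (forall w, In w ws -> (2 <= w < k)%nat) /\
    c 1%nat = (if Nat.eqb m 1 then RtoC 1 else RtoC 0) + Csum eisenstein_const ws.
Proof.
  intros Hnm [le [lf [Hle [Hlf [He [Hf [Hk ->]]]]]]].
  rewrite conv_1, (eis_list_0 le He), (eis_list_1 le He), (cusp_list_1 lf Hf), Hlf.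
  destruct (Nat.eqb_spec m 0) as [->|Hm].
  (* Without cuspidal factors there are at least two Eisenstein factors. The others take up weight
     at least 4, so each weight is below [k]. *)
  - destruct lf; [|discriminate]. exists (map fst le).
    split; [now rewrite length_map|]. split.
    + intros w Hw. apply in_map_iff in Hw. destruct Hw as [x [<- Hx]].
      split; [destruct (He x Hx); lia|].
      destruct (in_split x le Hx) as [l1 [l2 El]].
      assert (Hw := eis_list_weight (l1 ++ l2)
        ltac:(intros y Hy; apply He; rewrite El; apply in_app_or in Hy; apply in_or_app; simpl; tauto)).
      rewrite El in Hle, Hk. rewrite map_app, list_sum_app in Hk, Hw. rewrite length_app in Hle, Hw.
      simpl in Hle, Hk. lia.
    + rewrite Csum_map. simpl. change (conv_unit 0) with (RtoC 1). ring.
  (* A cuspidal factor has no constant term, so no [C_w] survives in the coefficient at 1. *)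
  - exists nil. split; [reflexivity|]. split; [contradiction|].
    rewrite cusp_list_0; [rewrite Csum_nil; ring| |exact Hf]. intros ->. simpl in Hlf. lia.
Qed.

(** The list of multipliers and the constant are explicit in [A], [n] and [m], hence the same for
    every choice of forms; only the weights in [L] vary. This is the shape that [no_relation]
    requires. *)
Lemma lhs_coef_1 (A : nat -> C) (n m : nat -> nat) k c l :
  (forall i, In i l -> (2 <= n i + m i)%nat) ->
  (forall i, In i l -> term_coef (n i) (m i) k (c i)) ->
  exists L, map fst L = flat_map (fun i => repeat (A i) (if Nat.eqb (m i) 0 then n i else 0%nat)) l /\
    (forall x, In x L -> (2 <= snd x < k)%nat) /\
    Csum (fun i => A i * c i 1%nat) l
    = Csum (fun i => A i * (if Nat.eqb (m i) 1 then RtoC 1 else RtoC 0)) l + eis_combination L.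
Proof.
  induction l as [|i l IH]; intros Hnm Hc.
  - exists nil. split; [reflexivity|]. split; [contradiction|].
    unfold eis_combination. rewrite !Csum_nil. ring.
  - destruct IH as [L [H1 [H2 H3]]]; [intros; apply Hnm; simpl; auto|intros; apply Hc; simpl; auto|].
    destruct (term_coef_1 _ _ k (c i) (Hnm i (or_introl eq_refl)) (Hc i (or_introl eq_refl))) as [ws [W1 [W2 W3]]].
    exists (map (fun w => (A i, w)) ws ++ L). split; [|split].
    + rewrite map_app, H1, map_map. simpl flat_map. f_equal. rewrite <- W1. clear.
      induction ws as [|w ws IH]; [reflexivity|]. simpl. now f_equal.
    + intros x Hx. apply in_app_or in Hx. destruct Hx as [Hx|Hx]; [|now apply H2].
      apply in_map_iff in Hx. destruct Hx as [w [<- Hw]]. now apply W2.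
    + rewrite !Csum_cons, H3, W3. unfold eis_combination.
      rewrite Csum_app, Csum_map. cbn [fst snd]. rewrite (Csum_scal _ eisenstein_const). ring.
Qed.

Lemma eisenstein_case (A : nat -> C) (n m : nat -> nat) l :
  (forall i, In i l -> (2 <= n i + m i)%nat) -> exists k0,
  forall k c, (k0 <= k)%nat -> (forall i, In i l -> term_coef (n i) (m i) k (c i)) ->
  eisenstein_coef k 1 <> Csum (fun i => A i * c i 1%nat) l.
Proof.
  intros Hnm.
  destruct (eis_no_relation _ (flat_map (fun i => repeat (A i) (if Nat.eqb (m i) 0 then n i else 0%nat)) l)
    (Csum (fun i => A i * (if Nat.eqb (m i) 1 then RtoC 1 else RtoC 0)) l) (Nat.le_refl _)) as [k0 Hk0].
  exists k0. intros k c Hk Hc E.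
  destruct (lhs_coef_1 A n m k c l Hnm Hc) as [L [H1 [H2 H3]]].
  apply (Hk0 k L Hk).
  - rewrite H1. apply Permutation_refl.
  - exact H2.
  - rewrite <- H3, <- E. unfold eisenstein_coef.
    replace (divisor_sigma (k - 1) 1) with 1%nat; [simpl; ring|].
    unfold divisor_sigma, divisors. simpl. now rewrite Nat.pow_1_l.
Qed.

(** Finite choice by induction on the list; [x0] is a default value off the list. *)
Lemma choice_on_list (X : Type) (Rel : nat -> X -> Prop) (x0 : X) l :
  (forall i, In i l -> exists x, Rel i x) -> exists c, forall i, In i l -> Rel i (c i).
Proof.
  induction l as [|i l IH]; intros H; [exists (fun _ => x0); contradiction|].
  destruct IH as [c Hc]; [intros; apply H; simpl; auto|].
  destruct (H i (or_introl eq_refl)) as [x Hx].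
  exists (fun j => if Nat.eqb j i then x else c j). intros j [<-|Hj].
  - now rewrite Nat.eqb_refl.
  - destruct (Nat.eqb_spec j i) as [->|_]; [exact Hx|now apply Hc].
Qed.

Theorem theorem2p1 (r : nat) (hr : (1 <= r)%nat)
  (A : nat -> C) (n m : nat -> nat)
  (hnm : forall i : nat, (1 <= i <= r)%nat -> (2 <= n i + m i)%nat) :
  finitely_many (fun h : C -> C =>
    exists k : nat, eigenform k h /\
    exists P F : nat -> C -> C,
      (forall i : nat, (1 <= i <= r)%nat ->
         exists u v : nat,
           product_of eisenstein (n i) u (P i) /\
           product_of cuspidal_eigenform (m i) v (F i) /\
           (u + v)%nat = k) /\
      (forall z : C, upper z ->
         Csum (fun i : nat => A i * P i z * F i z)%C (seq 1 r) = h z)).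
Proof.
  set (l := seq 1 r).
  assert (Hl : forall i, In i l -> (1 <= i <= r)%nat) by (intros i Hi; apply in_seq in Hi; lia).
  assert (Hnm : forall i, In i l -> (2 <= n i + m i)%nat) by auto.
  destruct (cuspidal_case A n m l Hnm) as [k1 Hk1].
  destruct (eisenstein_case A n m l Hnm) as [k2 Hk2].
  (* It remains to exclude weights from [k1 + k2] on, where both thresholds are exceeded. *)
  apply (finitely_many_subset _ _) with (2 := eigenforms_finite (k1 + k2)).
  intros h [k [Hh [P [F [HPF Hsum]]]]]. exists k. split; [|exact Hh].
  destruct (Nat.lt_ge_cases k (k1 + k2)) as [Hk|Hk]; [exact Hk|exfalso].
  destruct (choice_on_list _ (fun i c => term_coef (n i) (m i) k c /\ fourier (fun z => P i z * F i z) c)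
    conv_unit l) as [c Hc].
  { intros i Hi. destruct (HPF i (Hl i Hi)) as [u [v [HP [HF Huv]]]].
    destruct (product_of_coef eisenstein eis_coef (n i) u (P i)) as [le [E1 [E2 [E3 E4]]]]; [|exact HP|].
    { intros w f [Hw [_ Hf]]. exists (eisenstein_coef w). repeat split; assumption. }
    destruct (product_of_coef cuspidal_eigenform eigen_coef (m i) v (F i)) as [lf [F1 [F2 [F3 F4]]]]; [|exact HF|].
    { intros w f Hf. now apply cuspidal_eigenform_coef. }
    exists (conv (conv_list le) (conv_list lf)). split; [|now apply fourier_mult].
    exists le, lf. rewrite E3, F3. exact (conj E1 (conj F1 (conj E2 (conj F2 (conj Huv eq_refl))))). }
  assert (HF : fourier h (fun N => Csum (fun i => A i * c i N) l)).
  { apply (fourier_ext (fun z => Csum (fun i => A i * (P i z * F i z)) l)).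
    - intros z Hz. rewrite <- Hsum by exact Hz. apply Csum_ext. intros i _. ring.
    - apply (fourier_Csum _ (fun i z => A i * (P i z * F i z)) (fun i N => A i * c i N)).
      intros i Hi. apply fourier_scal. now apply Hc. }
  assert (Hterm : forall i, In i l -> term_coef (n i) (m i) k (c i)) by (intros i Hi; now apply Hc).
  destruct Hh as [[_ [_ Hh]]|Hh].
  - apply (Hk2 k c ltac:(lia) Hterm).
    exact (fourier_unique _ _ _ _ Hh HF (fun _ _ => eq_refl) 1%nat).
  - destruct (cuspidal_eigenform_coef k h Hh) as [_ [b [Hb1 Hb2]]].
    apply (Hk1 k b c ltac:(lia) Hb2 Hterm).
    exact (fourier_unique _ _ _ _ Hb1 HF (fun _ _ => eq_refl)).
Qed.
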